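(* Fix $\alpha > 0$. For each positive integer $d$ (large enough that $\lfloor \alpha d^2\rfloor\geq 1$), let $\rho_d$ be a random state on $\mathbb{C}^d \otimes \mathbb{C}^d$ chosen according to the measure $\mu_{d^2,\lfloor \alpha d^2 \rfloor}$. Then for every interval $I=[a,b] \subset \mathbb{R}$ and every $\varepsilon >0$, \[ \lim_{d \to \infty} \mathbf{P} \left( \left| N_{d^2 \rho_d^\Gamma}(I) - \mu_{SC(1,1/\alpha)}(I) \right| > \varepsilon \right) = 0 .\]
   Context: A state on $\mathbb{C}^n$ is a positive semidefinite operator on $\mathbb{C}^n$ with trace $1$. For positive integers $n,p$, $\mu_{n,p}$ is the distribution of the random state $\mathrm{Tr}_{\mathbb{C}^p}|x\rangle\langle x|$, where $x$ is uniformly distributed on the unit sphere of $\mathbb{C}^n\otimes\mathbb{C}^p$ and $\mathrm{Tr}_{\mathbb{C}^p}=\mathrm{Id}_{M(\mathbb{C}^n)}\otimes \mathrm{Tr}: M(\mathbb{C}^n\otimes\mathbb{C}^p)\to M(\mathbb{C}^n)$ is the partial trace. Here $n=d^2$ and $\mathbb{C}^{d^2}$ is identified with $\mathbb{C}^d\otimes\mathbb{C}^d$. For an operator $A$ on $\mathbb{C}^d\otimes\mathbb{C}^d$, $A^\Gamma=(\mathrm{Id}\otimes T)(A)$ is the partial transposition, where $T$ is the usual transposition on $M(\mathbb{C}^d)$ (equivalently, view $A$ as a $d\times d$ block matrix with $d\times d$ blocks and transpose each block). For a Hermitian $n\times n$ matrix $A$ with eigenvalues $\lambda_1,\dots,\lambda_n$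 (with multiplicity), $N_A=\frac1n\sum_{i=1}^n\delta_{\lambda_i}$; thus $N_{d^2\rho_d^\Gamma}([a,b])$ is the proportion of eigenvalues of $\rho_d^\Gamma$ in $[a/d^2,b/d^2]$. For $m\in\mathbb{R}$, $\sigma>0$, $\mu_{SC(m,\sigma^2)}$ is the semicircular distribution with support $[m-2\sigma,m+2\sigma]$ and density $\frac{1}{2\pi\sigma^2}\sqrt{4\sigma^2-(x-m)^2}$ there. *)

(* Defs.v *)
From HB Require Import structures.
From mathcomp Require Import all_boot all_order all_algebra.
From mathcomp Require Import complex mxtens.
From mathcomp Require Import all_classical all_reals all_analysis.

Set Implicit Arguments.
Unset Strict Implicit.
Unset Printing Implicit Defensive.

Import Order.TTheory GRing.Theory Num.Theory.
Import numFieldNormedType.Exports.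

Local Open Scope classical_set_scope.
Local Open Scope ring_scope.
Local Open Scope sesquilinear_scope.

(* The ascription lets the field, norm and topology of the complex numbers be
   inferred on matrix types; the bare type [complex R] carries no canonical
   topology. *)
Definition Cplx (R : realType) : numClosedFieldType := complex R.

Definition borelM (R : realType) (m n : nat) :=
  @g_sigma_algebraType 'M[Cplx R]_(m, n) open.

Section tensor_operators.
Context {K : pzRingType}.

(* Id (x) Tr : M(C^m (x) C^n) -> M(C^m).  The basis vector e_i (x) e_j of
   C^m (x) C^n has index [mxtens_index (i, j)], i.e. i * n + j. *)
Definition ptrace {m n : nat} (A : 'M[K]_(m * n)) : 'M[K]_m :=
  \matrix_(i, j) \sum_(k < n) A (mxtens_index (i, k)) (mxtens_index (j, k)).

(* Id (x) T: the entry at ((i, j), (k, l)) is the entry of A at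
   ((i, l), (k, j)). *)
Definition ptranspose {m n : nat} (A : 'M[K]_(m * n)) : 'M[K]_(m * n) :=
  \matrix_(r, c)
    A (mxtens_index ((mxtens_unindex r).1, (mxtens_unindex c).2))
      (mxtens_index ((mxtens_unindex c).1, (mxtens_unindex r).2)).

End tensor_operators.

Lemma ptrace_tens (K : comPzRingType) (m n : nat) (A : 'M[K]_m) (B : 'M[K]_n) :
  ptrace (tensmx A B) = \tr B *: A.
Proof.
apply/matrixP => i j; rewrite !mxE mulrC /mxtrace mulr_sumr.
by apply: eq_bigr => k _; rewrite !mxE !mxtens_indexK.
Qed.

Lemma ptranspose_tens (K : pzRingType) (m n : nat)
    (A : 'M[K]_m) (B : 'M[K]_n) :
  ptranspose (tensmx A B) = tensmx A B^T.
Proof. by apply/matrixP => r c; rewrite !mxE !mxtens_indexK. Qed.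

Section random_states.
Context {R : realType}.

Definition unit_sphere (N : nat) : set 'cV[Cplx R]_N :=
  [set x | \sum_(i < N) `|x i 0| ^+ 2 = 1].

(* The uniform measure on the unit sphere of C^N is the unique Borel
   probability measure carried by the sphere and invariant under U(N). *)
Definition uniform_on_sphere (N : nat) (nu : probability (borelM R N 1) R) :=
  nu (@unit_sphere N) = 1%E /\
  (forall U : 'M[Cplx R]_N, U \is unitarymx ->
   forall A : set (borelM R N 1), measurable A ->
     nu ((fun x : 'cV[Cplx R]_N => U *m x) @^-1` A) = nu A).

(* Tr_{C^p} |x><x| for x in C^n (x) C^p *)
Definition reduced_state (n p : nat) (x : 'cV[Cplx R]_(n * p)) :
    'M[Cplx R]_n :=
  ptrace (x *m x ^t*).

(* rho has distribution mu_{n,p}, the image of the uniform measure under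
   [reduced_state]. *)
Definition has_law_mu (disp : measure_display) (T : measurableType disp)
    (P : probability T R) (n p : nat) (rho : {RV P >-> borelM R n n}) :=
  exists nu : probability (borelM R (n * p) 1) R,
    uniform_on_sphere nu /\
    (forall A : set (borelM R n n), measurable A ->
       distribution P rho A = nu (@reduced_state n p @^-1` A)).

(* For Hermitian A the entries of [spectral_diag A] are the (real) eigenvalues
   of A with multiplicity. *)
Definition spectral_measure (n : nat) (A : 'M[Cplx R]_n) (S : set R) : R :=
  n%:R^-1 * \sum_(i < n) \1_S (complex.Re (spectral_diag A 0 i)).

(* The law SC(m, v); v is the variance (sigma^2), as in the usual notation. *)
Definition semicircle_pdf (m v x : R) : R :=
  (2 * pi * v)^-1 * Num.sqrt (4 * v - (x - m) ^+ 2).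

Definition semicircle (m v : R) (S : set R) : R :=
  \int[@lebesgue_measure R]_(x in S `&`
      `[m - 2 * Num.sqrt v, m + 2 * Num.sqrt v])
    semicircle_pdf m v x.

End random_states.

(* Main.v *)
(** Invariance of the sphere measure under the unitary group yields
    Schwinger-Dyson equations for the expectation of a monomial in the
    coordinates and their conjugates.  The traces of powers of the rescaled
    partial transpose M are sums of monomials over index patterns ("networks")
    encoded by a pair of permutations (g, h), and the equations become a
    recursion that removes one point of a network at a time, each removal being
    weighted by powers of d and p according to the cycles it splits or merges.
    After normalisation only the removals that split cycles of both g and h
    survive as d grows; partial transposition makes h = g^-1, and the limits are
    products over the cycles of weighted Motzkin numbers, the moments of
    SC(1, 1/alpha).  Two cycles give E[tr_k tr_l] -> c_k c_l, so that normalised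
    traces of polynomials in M converge in mean square.  Polynomials above and
    below the indicator of [a, b], with integrals close to the semicircle measure
    of [a, b], transfer this to the spectral measure by Chebyshev's inequality. *)

Require Import Defs.
From HB Require Import structures.
From mathcomp Require Import all_boot all_order all_algebra all_fingroup.
From mathcomp Require Import complex mxtens.
From mathcomp Require Import all_classical all_reals all_analysis measurable_realfun.
From mathcomp Require Import ring lra zify.

Set Implicit Arguments.
Unset Strict Implicit.
Unset Printing Implicit Defensive.

Import Order.TTheory GRing.Theory Num.Theory.
Import numFieldNormedType.Exports.

(** * Weighted Motzkin numbers *)

Section motzkin.
Local Open Scope ring_scope.
Variables (K : comNzRingType) (m v : K).

(* The weighted number of Motzkin paths of length [k] from height [0] to height
   [j], where each level step has weight [m] and each down step weight [v]. *)
Fixpoint motzkin (k j : nat) : K :=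
  if k is k'.+1 then
    (if j is j'.+1 then motzkin k' j' else 0) + m * motzkin k' j + v * motzkin k' j.+1
  else (j == 0)%:R.

(* Decomposition of a path at its last visit to the level [0]. *)
Lemma motzkin_last_return k j :
  motzkin k j.+1 = \sum_(i < k) motzkin i 0 * motzkin (k - i.+1) j.
Proof.
elim: k j => [|k IH] j; first by rewrite big_ord0.
rewrite big_ord_recr /= subnn.
under eq_bigr => i _ do
  rewrite subSS -(subnSK (ltn_ord i)) /= 2!mulrDr [_ * (m * _)]mulrCA [_ * (v * _)]mulrCA.
rewrite !big_split /= -!mulr_sumr -!IH.
case: j => [|j] /=; last by rewrite mulr0 addr0 IH.
by rewrite big1 => [|i _]; rewrite ?mulr0 // mulr1 add0r addrC -addrA.
Qed.

Lemma motzkinSS k j :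
  motzkin k.+1 j.+1 = motzkin k j + m * motzkin k j.+1 + v * motzkin k j.+2.
Proof. by []. Qed.

Lemma motzkinS0 k : motzkin k.+1 0 = m * motzkin k 0 + v * motzkin k 1.
Proof. by rewrite /= add0r. Qed.

Lemma motzkin_first_return k : motzkin k.+1 0 =
  m * motzkin k 0 + v * \sum_(i < k) motzkin i 0 * motzkin (k - i.+1) 0.
Proof. by rewrite motzkinS0 motzkin_last_return. Qed.

End motzkin.
Arguments motzkin : simpl never.

(** * Splicing points out of permutations *)

Section splice.
Variable S : finType.
Implicit Types (s t x y : S) (f g : {perm S}) (A : {set S}) (q r : seq S).

(* [f] with the point [s] taken out of its cycle and made a fixed point. *)
Definition skip s f : {perm S} := (f * tperm s (f s))%g.

Lemma skipE s f x :
  skip s f x = if f x == s then f s else if x == s then s else f x.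
Proof.
rewrite permM; have [->|fxs] := eqVneq (f x) s; first by rewrite tpermL.
have [->|xs] := eqVneq x s; first by rewrite tpermR.
by rewrite tpermD 1?eq_sym // (inj_eq perm_inj).
Qed.

Lemma skip_id s f : skip s f s = s.
Proof. by rewrite permM tpermR. Qed.

Lemma skip_neq s f x : x != s -> skip s f x != s.
Proof. by move=> xs; rewrite -[X in _ != X](skip_id s f) (inj_eq perm_inj). Qed.

Lemma skip_inv s f : skip s f^-1%g = (skip s f)^-1%g.
Proof.
by rewrite /skip invMg tpermV [RHS]conjgC tpermJ permK tpermC.
Qed.

Lemma skip_conj s f g : skip (g s) (f ^ g)%g = (skip s f ^ g)%g.
Proof. by rewrite /skip conjMg tpermJ permJ. Qed.

Lemma skipC s t f : skip s (skip t f) = skip t (skip s f).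
Proof.
have [->//|st] := eqVneq s t; have ts : t != s by rewrite eq_sym.
have fne y x : x != y -> f y != f x by rewrite (inj_eq perm_inj) eq_sym.
apply/permP => x.
have [->|xs] := eqVneq x s; first by rewrite skip_id [RHS]skipE skip_id (negbTE st).
have [->|xt] := eqVneq x t; first by rewrite skip_id skipE skip_id (negbTE ts).
have [fxt|fxt] := eqVneq (f x) t.
  have fst : f s != t by rewrite -fxt fne.
  by rewrite !skipE fxt !eqxx (negbTE ts) (negbTE st) (negbTE fst) (negbTE xs) eqxx; case: ifP.
have [fxs|fxs] := eqVneq (f x) s.
  have fts : f t != s by rewrite -fxs fne.
  by rewrite !skipE fxs !eqxx (negbTE ts) (negbTE st) (negbTE fts) (negbTE xt) eqxx; case: ifP.
by rewrite !skipE !(negbTE fxt, negbTE fxs, negbTE xs, negbTE xt).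
Qed.

Lemma perm_on_skip A s f : perm_on A f -> s \in A -> perm_on (A :\ s) (skip s f).
Proof.
move=> fA sA; apply/fintype.subsetP => x; rewrite !inE.
apply: contraR; rewrite negb_and negbK => /orP[/eqP->|xA]; first by rewrite skip_id.
rewrite skipE (out_perm fA xA); have xs : x != s by apply: contraNneq xA => ->.
by rewrite (negbTE xs).
Qed.

(* What is left of [g] when [s] is removed: [s] becomes a fixed point, [t] is
   sent to [g s] and the predecessor of [s] to [g t]. *)
Definition splice s t g : {perm S} := skip s (tperm s t * g)%g.

Lemma spliceE s t g x : splice s t g x = tperm s (g t) (g (tperm s t x)).
Proof. by rewrite /splice /skip !permM tpermL. Qed.

Lemma splice_head t g : splice t t g = skip t g.
Proof. by rewrite /splice tperm1 mul1g. Qed.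

Lemma splice_neq s t g x : x != s -> splice s t g x != s.
Proof. exact: skip_neq. Qed.

Lemma perm_on_splice A s t g : perm_on A g -> s \in A -> t \in A ->
  perm_on (A :\ s) (splice s t g).
Proof.
move=> gA sA tA; apply: perm_on_skip => //; apply: perm_onM => //.
by apply/fintype.subsetP => x; rewrite inE; case: tpermP => [->|->|]; rewrite ?eqxx.
Qed.

Lemma splice_skip_inv s t g :
  skip t (splice s t g^-1%g) = (skip t (splice s t g))^-1%g.
Proof.
rewrite /splice -!skip_inv invMg tpermV; set h := (tperm s t * g^-1)%g.
have -> : (g^-1 * tperm s t)%g = (h ^ tperm s t)%g.
  by rewrite conjgE tpermV !mulgA tperm2 mul1g.
have -> : skip t (skip s (h ^ tperm s t)%g) = (skip s (skip t h) ^ tperm s t)%g.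
  by rewrite -!skip_conj tpermR tpermL.
rewrite (skipC t s); set k := skip s (skip t h).
have ks : k s = s by rewrite skip_id.
have kt : k t = t by rewrite /k skipC skip_id.
rewrite conjgE; have -> : (k * tperm s t = tperm s t * k)%g.
  by rewrite [RHS]conjgC tpermJ ks kt.
by rewrite mulKg.
Qed.

Lemma card_porbits_splice s t g :
  (#|porbits (splice s t g)| + (s \notin porbit g t).*2 =
   #|porbits g| + (s != t) + (g t != s))%N.
Proof.
set h := (tperm s t * g)%g.
have -> : splice s t g = (tperm (h^-1%g s) s * h)%g.
  by rewrite /splice /skip -/h [RHS]conjgC tpermJ permKV.
have := porbits_mul_tperm h ((h^-1)%g s) s; rewrite /=.
have -> : (h^-1)%g s \in porbit h s.
  by rewrite -porbitV; have := mem_porbit (h^-1)%g 1 s; rewrite expg1.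
rewrite addn0 => ->; have := porbits_mul_tperm g s t; rewrite /= -/h => cut_porbits.
rewrite addnAC cut_porbits; congr (_ + ~~ _)%N.
by rewrite -(inj_eq (@perm_inj _ h)) permKV eq_sym permM tpermL.
Qed.

Lemma fcycle_porbit g t r : fcycle g (t :: r) -> porbit g t =i t :: r.
Proof.
move=> gq x; apply/porbitP/idP => [[i ->]|].
  rewrite permX; elim: i => [|i IH] /=; first exact: mem_head.
  exact: mem_fcycle gq _ IH.
by rewrite (fcycle_consE gq) => /trajectP[i _ ->]; exists i; rewrite permX.
Qed.

Lemma fpath_rcons_eq g h s t r z : h t = g s -> {in r, h =1 g} ->
  fpath h t (rcons r z) = fpath g s (rcons r z).
Proof.
elim: r s t => [|y l IH] s t /= -> // hg; congr (_ && _).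
by apply: IH => [|x xl]; rewrite hg ?mem_head // inE xl orbT.
Qed.

Lemma fcycle_cut s t g r1 r2 : uniq (t :: r1 ++ s :: r2) ->
  fcycle g (t :: r1 ++ s :: r2) =
  fcycle (tperm s t * g)%g (s :: r1) && fcycle (tperm s t * g)%g (t :: r2).
Proof.
rewrite /= mem_cat inE !negb_or cat_uniq /= negb_or.
move=> /andP[/and3P[tr1 _ tr2] /and4P[_ /andP[sr1 _] sr2 _]].
have off r : s \notin r -> t \notin r -> {in r, (tperm s t * g)%g =1 g}.
  move=> sr tr x xr; rewrite permM tpermD //.
    by apply: contraNneq sr => ->.
  by apply: contraNneq tr => ->.
rewrite (@fpath_rcons_eq g _ t s r1) ?permM ?tpermL //; last exact: off.
rewrite (@fpath_rcons_eq g _ s t r2) ?permM ?tpermR //; last exact: off.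
by rewrite rcons_cat -cat_rcons cat_path last_rcons.
Qed.

Lemma fcycle_skip_notin s g q : s \notin q -> fcycle g q -> fcycle (skip s g) q.
Proof.
move=> sq; apply: (sub_in_cycle (P := predC1 s)) => [x y xs ys /eqP gxy|].
  by rewrite /= skipE gxy (negbTE ys) (negbTE xs).
by apply/allP => x xq; apply: contraNneq sq => <-.
Qed.

Lemma fcycle_skip_head t g r : uniq (t :: r) ->
  fcycle g (t :: r) -> fcycle (skip t g) r.
Proof.
case: r => [//|y l] /= /andP[tyl _]; rewrite !rcons_path => /and3P[/eqP gt gyl /eqP gl].
rewrite /= skipE gl gt !eqxx andbT.
apply: (sub_in_path (P := predC1 t)) gyl => [x z xt zt /eqP gxz|].
  by rewrite /= skipE gxz (negbTE zt) (negbTE xt).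
by apply/allP => x xyl; apply: contraNneq tyl => <-.
Qed.

Lemma fcycle_splice_notin s t g q : s \notin q -> t \notin q ->
  fcycle g q -> fcycle (splice s t g) q.
Proof.
move=> sq tq gq; apply: fcycle_skip_notin => //.
have cut_eq : {in q &, frel (tperm s t * g)%g =2 frel g}.
  move=> x y xq _ /=; rewrite permM tpermD //.
    by apply: contraNneq sq => ->.
  by apply: contraNneq tq => ->.
by rewrite (eq_in_cycle cut_eq) //; apply/allP.
Qed.

Lemma fcycle_splice s t g r1 r2 : uniq (t :: r1 ++ s :: r2) ->
  fcycle g (t :: r1 ++ s :: r2) ->
  fcycle (splice s t g) r1 /\ fcycle (splice s t g) (t :: r2).
Proof.
move=> uq; rewrite fcycle_cut // => /andP[cyc1 cyc2].
move: uq; rewrite /= mem_cat inE !negb_or cat_uniq /= negb_or.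
move=> /andP[/and3P[_ ts _] /and4P[ur1 /andP[sr1 _] sr2 _]]; split.
  by apply: fcycle_skip_head cyc1; rewrite /= sr1.
by apply: fcycle_skip_notin cyc2; rewrite inE negb_or sr2 eq_sym ts.
Qed.

Lemma fcycle_inv g q : fcycle g q -> fcycle (g^-1)%g (rev q).
Proof.
rewrite rev_cycle; congr is_true; apply: eq_cycle => x y /=.
by apply/eqP/eqP => [<-|<-]; rewrite ?permK ?permKV.
Qed.

(* The cycles of [t] in the splices of [g] and of its inverse run through
   complementary arcs. *)
Lemma porbit_splice_inv s t g r x : uniq (t :: r) -> s \in r -> fcycle g (t :: r) ->
  x \in porbit (splice s t g) t -> x \in porbit (splice s t g^-1%g) t -> x = t.
Proof.
move=> + /splitPr sr; case: sr => r1 r2 ur cyc.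
have rev_rotr : rotr 1 (rev (t :: r1 ++ s :: r2)) = t :: rev r2 ++ s :: rev r1.
  by rewrite rev_cons rotr1_rcons rev_cat rev_cons cat_rcons.
have cycV : fcycle g^-1%g (t :: rev r2 ++ s :: rev r1).
  by rewrite -rev_rotr rotr_cycle fcycle_inv.
have urV : uniq (t :: rev r2 ++ s :: rev r1) by rewrite -rev_rotr rotr_uniq rev_uniq.
rewrite (fcycle_porbit (fcycle_splice ur cyc).2) (fcycle_porbit (fcycle_splice urV cycV).2).
rewrite !inE mem_rev; case: eqVneq => //= _ xr2 xr1.
move: ur; rewrite cons_uniq cat_uniq => /and4P[_ _ /hasPn/(_ x)].
by rewrite inE xr2 orbT xr1 => /(_ isT).
Qed.

Definition has_cycles (qs : seq (seq S)) g :=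
  [/\ uniq (flatten qs), all (fcycle g) qs & perm_on [set x in flatten qs] g].

Lemma notin_flatten x qs q : x \notin flatten qs -> q \in qs -> x \notin q.
Proof. by move=> xqs qqs; apply: contra xqs => xq; apply/flattenP; exists q. Qed.

Lemma set_consD1 x r : x \notin r -> [set y in x :: r] :\ x = [set y in r].
Proof.
move=> xr; apply/setP => y; rewrite !inE; case: eqVneq => [->|] //=.
exact/esym/negbTE.
Qed.

Lemma has_cycles_skip t g r qs : has_cycles ((t :: r) :: qs) g ->
  has_cycles (r :: qs) (skip t g).
Proof.
move=> [uq /andP[gr gqs] gA]; have [tr_qs uqs] := andP uq.
have : uniq ((t :: r) ++ flatten qs) by [].
rewrite cat_uniq => /and3P[utr _ _]; split=> //=.
  rewrite (fcycle_skip_head utr gr) /=.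
  have tqs : t \notin flatten qs by apply: contra tr_qs; rewrite mem_cat orbC => ->.
  apply/allP => q qqs; apply: fcycle_skip_notin (allP gqs q qqs).
  exact: notin_flatten qqs.
by rewrite -(set_consD1 tr_qs) perm_on_skip // inE mem_head.
Qed.

Lemma perm_flatten_splice s t r1 r2 qs :
  perm_eq (flatten ((t :: r1 ++ s :: r2) :: qs)) (s :: flatten [:: t :: r2, r1 & qs]).
Proof. by apply/seq.permP => P; rewrite /= !count_cat /=; ring. Qed.

Lemma set_flatten_splice s t r1 r2 qs : uniq (flatten ((t :: r1 ++ s :: r2) :: qs)) ->
  [set x in flatten ((t :: r1 ++ s :: r2) :: qs)] :\ s =
  [set x in flatten [:: t :: r2, r1 & qs]].
Proof.
have reorder := perm_flatten_splice s t r1 r2 qs.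
rewrite (perm_uniq reorder) => /andP[/set_consD1 <- _]; congr (_ :\ _).
by apply/setP => x; rewrite !finset.in_set (perm_mem reorder).
Qed.

Lemma has_cycles_splice s t g r1 r2 qs : has_cycles ((t :: r1 ++ s :: r2) :: qs) g ->
  has_cycles [:: t :: r2, r1 & qs] (splice s t g).
Proof.
move=> [uq /andP[gr gqs] gA]; have reorder := perm_flatten_splice s t r1 r2 qs.
have /andP[s_new u_new] : uniq (s :: flatten [:: t :: r2, r1 & qs]).
  by rewrite -(perm_uniq reorder).
have : uniq ((t :: r1 ++ s :: r2) ++ flatten qs) by [].
rewrite cat_uniq => /and3P[ur /hasPn r_qs _].
have notin x : x \in t :: r1 ++ s :: r2 -> x \notin flatten qs.
  by move=> xr; apply/negP => /r_qs /=; rewrite xr.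
have [cyc1 cyc2] := fcycle_splice ur gr.
have sA : s \in [set x in flatten ((t :: r1 ++ s :: r2) :: qs)].
  by rewrite finset.in_set (perm_mem reorder) mem_head.
split=> //; last by rewrite -(set_flatten_splice uq) perm_on_splice // inE /= mem_head.
rewrite /= in cyc2 *; rewrite cyc2 cyc1 /=; apply/allP => q qqs.
apply: fcycle_splice_notin (allP gqs q qqs); apply: notin_flatten qqs; apply: notin.
  by rewrite inE mem_cat mem_head !orbT.
exact: mem_head.
Qed.

Lemma card_porbits_cycles qs g : has_cycles qs g ->
  [set x in flatten qs] = [set: S] -> #|porbits g| = count (predC1 [::]) qs.
Proof.
move=> [uq /allP cyc _] full.
pose blocks := [seq [set x in q] | q : seq S <- seq.filter (predC1 [::]) qs].
have porbit_block q x : q \in qs -> x \in q -> porbit g x = [set y in q].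
  move=> /cyc gq /rot_to[i r qE]; apply/setP => y; rewrite inE -(mem_rot i) qE.
  by apply: fcycle_porbit; rewrite -qE rot_cycle.
have -> : porbits g = [set B in blocks].
  apply/setP => B; rewrite inE; apply/imsetP/mapP => [[x _ ->]|[q]].
    have /flattenP[q qqs xq] : x \in flatten qs.
      by have := finset.in_setT x; rewrite -full inE.
    exists q; rewrite ?(porbit_block q) // mem_filter qqs andbT.
    by apply: contraTneq xq => ->.
  rewrite mem_filter => /andP[]; case: q => // x q _ qqs ->.
  by exists x => //; rewrite (porbit_block (x :: q)) ?mem_head.
suff ub : uniq blocks by rewrite cardsE (card_uniqP ub) size_map size_filter.
rewrite {}/blocks {cyc full porbit_block}; elim: qs uq => //= q qs IH.
rewrite cat_uniq => /and3P[_ /hasPn disj uqs].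
case: q disj => [|x q] disj /=; first exact: IH.
rewrite IH // andbT; apply/mapP => -[q']; rewrite mem_filter => /andP[_ q'qs].
move=> /setP/(_ x); rewrite !inE eqxx /= => /esym xq'.
have /disj /= : x \in flatten qs by apply/flattenP; exists q'.
by rewrite inE eqxx.
Qed.

End splice.

Section cycle_recursion.
Variables (S : finType) (K : comNzRingType) (v : K).
Variable L : {set S} -> {perm S} -> {perm S} -> K.
Implicit Types (s t : S) (g h : {perm S}) (A : {set S}) (qs : seq (seq S)).
Local Open Scope ring_scope.
Hypothesis L_empty : L finset.set0 1%g 1%g = 1.
Hypothesis L_rec : forall A g h t, perm_on A g -> perm_on A h -> t \in A ->
  L A g h = L (A :\ t) (skip t g) (skip t h) +
    v * \sum_(s in A | [&& s != t, s \in porbit g t & s \in porbit h t])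
           L (A :\ s) (splice s t g) (splice s t h).

Lemma recursion_isolated A g h t : perm_on A g -> perm_on A h -> t \in A ->
  (forall s, s \in porbit g t -> s \in porbit h t -> s = t) ->
  L A g h = L (A :\ t) (skip t g) (skip t h).
Proof.
move=> gA hA tA meet; rewrite (L_rec gA hA tA) big_pred0 ?mulr0 ?addr0 // => s.
by apply/and4P => -[_ /eqP st sg sh]; case: st; exact: meet.
Qed.

Local Notation diagL qs g := (L [set x in flatten qs] g g^-1%g).

Lemma recursion_splice s t g r1 r2 qs : has_cycles ((t :: r1 ++ s :: r2) :: qs) g ->
  L ([set x in flatten ((t :: r1 ++ s :: r2) :: qs)] :\ s)
    (splice s t g) (splice s t g^-1%g) =
  diagL [:: r2, r1 & qs] (skip t (splice s t g)).
Proof.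
move=> cyc; have [_ /andP[gr _] gA] := cyc; have [ur _ _] := cyc.
set A := [set x in _] in gA *.
have cyc' := has_cycles_splice cyc; have [u_new _ _] := cyc'.
have utr : uniq (t :: r1 ++ s :: r2).
  by move: ur; rewrite [flatten _]/= -cat_cons cat_uniq => /andP[].
have st : s != t.
  by move: utr; rewrite /= mem_cat inE !negb_or eq_sym => /andP[/and3P[]].
have [sA tA] : s \in A /\ t \in A.
  by split; rewrite !inE ?eqxx //= mem_cat mem_cat mem_head !orbT.
have tA' : t \in A :\ s by rewrite finset.in_setD1 eq_sym st.
rewrite (@recursion_isolated _ _ _ t) ?perm_on_splice ?perm_onV //; last first.
  move=> x; apply: porbit_splice_inv utr _ gr.
  by rewrite mem_cat mem_head orbT.
by rewrite splice_skip_inv /A set_flatten_splice // set_consD1 //; case/andP: u_new.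
Qed.

Lemma sum_cycle_tail t r qs g (F : S -> K) : has_cycles ((t :: r) :: qs) g ->
  \sum_(s in [set x in flatten ((t :: r) :: qs)] |
      [&& s != t, s \in porbit g t & s \in porbit g^-1%g t]) F s =
  \sum_(i < size r) F (nth t r i).
Proof.
move=> [uq /andP[gr _] _].
have /andP[tr ur] : uniq (t :: r).
  by move: uq; rewrite [flatten _]/= -cat_cons cat_uniq => /andP[].
rewrite (eq_bigl (mem r)) => [|s]; last first.
  rewrite porbitV (fcycle_porbit gr) !inE mem_cat /=.
  by case: eqVneq => [->|_]; rewrite ?(negbTE tr) //=; case: (s \in r); rewrite ?andbF.
by rewrite -big_uniq // (big_nth t) big_mkord.
Qed.

Lemma cycle_product qs g : has_cycles qs g ->
  diagL qs g = \prod_(q <- qs) motzkin 1 v (size q) 0.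
Proof.
have [n] := ubnP (size (flatten qs) + size qs); elim: n qs g => // n IH.
case=> [|[|t r] qs] g; rewrite ltnS => size_qs cyc; rewrite ?big_nil ?big_cons.
- have [_ _ gA] := cyc; have -> : g = 1%g.
    by apply/permP => x; rewrite perm1 (out_perm gA) // inE.
  by rewrite invg1 -L_empty; congr L; apply/setP => x; rewrite !inE.
- rewrite mul1r; apply: (IH qs g); first by rewrite -addnS.
  by case: cyc.
have [/andP[tr_qs _] _ gA] := cyc.
have tA : t \in [set x in flatten ((t :: r) :: qs)] by rewrite inE mem_head.
rewrite [size (t :: r)]/= motzkin_first_return mul1r mulrDl (L_rec gA (perm_onV gA) tA).
congr (_ + _).
  by rewrite skip_inv set_consD1 // (IH (r :: qs)) ?big_cons //; exact: has_cycles_skip.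
rewrite (sum_cycle_tail _ cyc) -mulrA big_distrl /=; congr (_ * _).
apply: eq_bigr => i _.
set s := nth t r i.
have rE : r = take i r ++ s :: drop i.+1 r by rewrite -drop_nth ?cat_take_drop.
have cyc_s : has_cycles ((t :: take i r ++ s :: drop i.+1 r) :: qs) g by rewrite -rE.
have := recursion_splice cyc_s; rewrite -[in LHS]rE => ->.
rewrite (IH [:: drop i.+1 r, take i r & qs]) ?big_cons; first last.
- by apply: has_cycles_skip; exact: has_cycles_splice.
- apply: leq_trans size_qs; rewrite /= !size_cat size_drop size_takel; last exact: ltnW.
  by have := ltn_ord i; lia.
rewrite size_drop size_takel; last exact: ltnW.
by rewrite mulrCA mulrA.
Qed.

End cycle_recursion.

Local Open Scope classical_set_scope.
Local Open Scope ring_scope.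
Local Open Scope sesquilinear_scope.

(** * Complex-valued integrals *)

Section complex_parts.
Context {R : realType}.
Local Notation C := (Cplx R).
Implicit Types (z w : C) (r : R).

Definition rpart (z : C) : R := complex.Re (z : complex R).
Definition ipart (z : C) : R := complex.Im (z : complex R).
Definition creal (r : R) : C := real_complex R r.

Fact rpart_is_zmod_morphism : zmod_morphism rpart.
Proof. by case=> a b [c d]. Qed.

Fact ipart_is_zmod_morphism : zmod_morphism ipart.
Proof. by case=> a b [c d]. Qed.

HB.instance Definition _ := GRing.isZmodMorphism.Build C R rpart rpart_is_zmod_morphism.
HB.instance Definition _ := GRing.isZmodMorphism.Build C R ipart ipart_is_zmod_morphism.
HB.instance Definition _ := GRing.RMorphism.copy creal (real_complex R).

Lemma complex_eqP z w : rpart z = rpart w -> ipart z = ipart w -> z = w.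
Proof. by case: z w => a b [c d] /= -> ->. Qed.

Lemma rpartM z w : rpart (z * w) = rpart z * rpart w - ipart z * ipart w.
Proof. by case: z w => a b [c d]. Qed.

Lemma ipartM z w : ipart (z * w) = rpart z * ipart w + ipart z * rpart w.
Proof. by case: z w => a b [c d]. Qed.

Lemma rpart_crealM r z : rpart (creal r * z) = r * rpart z.
Proof. by rewrite rpartM mul0r subr0. Qed.

Lemma creal_rpartE z : creal (rpart z) = 2^-1 * (z + z^*).
Proof.
have -> : 2^-1 = creal 2^-1 :> C by rewrite fmorphV rmorph_nat.
have [rJ iJ] : rpart z^* = rpart z /\ ipart z^* = - ipart z by case: z.
apply: complex_eqP; rewrite ?rpart_crealM ?ipartM raddfD /= ?rJ ?iJ.
  by rewrite -mulr2n -[X in _ * X]mulr_natl mulKf ?pnatr_eq0.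
by rewrite subrr mulr0 mul0r addr0.
Qed.

Lemma le_norm_rpart z : creal `|rpart z| <= `|z|.
Proof. exact: normc_ge_Re. Qed.

Lemma le_norm_ipart z : creal `|ipart z| <= `|z|.
Proof.
rewrite (normc_def z) lecR -sqrtr_sqr; apply: ler_wsqrtr.
by rewrite lerDr sqr_ge0.
Qed.

Lemma norm_rpart_le z w : `|z| <= w -> `|rpart z| <= rpart w.
Proof. by move=> zw; have := le_trans (le_norm_rpart z) zw; rewrite lecE => /andP[]. Qed.

Lemma norm_ipart_le z w : `|z| <= w -> `|ipart z| <= rpart w.
Proof. by move=> zw; have := le_trans (le_norm_ipart z) zw; rewrite lecE => /andP[]. Qed.

Lemma rpart_continuous : continuous rpart.
Proof.
move=> z; apply/(cvgrPdist_lt (FF := nbhs_filter z)) => e e0; exists (creal e) => /=.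
  by rewrite ltcR.
by move=> w /(le_lt_trans (le_norm_rpart _)); rewrite ltcR raddfB.
Qed.

Lemma ipart_continuous : continuous ipart.
Proof.
move=> z; apply/(cvgrPdist_lt (FF := nbhs_filter z)) => e e0; exists (creal e) => /=.
  by rewrite ltcR.
by move=> w /(le_lt_trans (le_norm_ipart _)); rewrite ltcR raddfB.
Qed.

Lemma conj_continuous : continuous (fun z : C => z^*).
Proof.
move=> z; apply/(cvgrPdist_lt (FF := nbhs_filter z)) => e e0; exists e => //= w.
by rewrite -rmorphB norm_conjC.
Qed.

End complex_parts.

Section complex_integral.
Context {d : measure_display} {T : measurableType d} {R : realType}.
Variables (mu : {measure set T -> \bar R}) (D : set T).
Hypothesis mD : measurable D.
Local Notation C := (Cplx R).
Implicit Types (f g : T -> C) (c : C).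

Definition cintegrable f :=
  mu.-integrable D (EFin \o (rpart \o f)) /\ mu.-integrable D (EFin \o (ipart \o f)).

Definition cintegral f : C :=
  Complex (\int[mu]_(x in D) rpart (f x)) (\int[mu]_(x in D) ipart (f x)).

Lemma eq_cintegral f g : (forall x, D x -> f x = g x) -> cintegral f = cintegral g.
Proof.
by move=> fg; congr Complex; apply: eq_Rintegral => x; rewrite inE => /fg ->.
Qed.

Lemma cintegrableD f g : cintegrable f -> cintegrable g ->
  cintegrable (fun x => f x + g x).
Proof.
move=> [fr fi] [gr gi]; split.
  by apply: eq_integrable (integrableD mD fr gr) => // x _; rewrite /= raddfD.
by apply: eq_integrable (integrableD mD fi gi) => // x _; rewrite /= raddfD.
Qed.

Lemma cintegralD f g : cintegrable f -> cintegrable g ->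
  cintegral (fun x => f x + g x) = cintegral f + cintegral g.
Proof.
move=> [fr fi] [gr gi]; apply: complex_eqP; rewrite raddfD /=.
  by rewrite -RintegralD //; apply: eq_Rintegral => x _; rewrite raddfD.
by rewrite -RintegralD //; apply: eq_Rintegral => x _; rewrite raddfD.
Qed.

Lemma cintegralZ c f : cintegrable f -> cintegral (fun x => c * f x) = c * cintegral f.
Proof.
move=> [fr fi]; have iZ (h : T -> R) (a : R) : mu.-integrable D (EFin \o h) ->
    mu.-integrable D (EFin \o (fun x => a * h x)).
  by move=> ih; apply: (integrableZl mD a ih).
apply: complex_eqP; rewrite ?rpartM ?ipartM /=.
  rewrite -!RintegralZl // -RintegralB ?iZ //.
  by apply: eq_Rintegral => x _; rewrite rpartM.
rewrite -!RintegralZl // -RintegralD ?iZ //.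
by apply: eq_Rintegral => x _; rewrite ipartM.
Qed.

Lemma cintegrable_sum (I : Type) (r : seq I) (P : pred I) (F : I -> T -> C) :
  (forall i, P i -> cintegrable (F i)) ->
  cintegrable (fun x => \sum_(i <- r | P i) F i x).
Proof.
move=> iF; elim: r => [|i r IH].
  under eq_fun do rewrite big_nil.
  by split; exact: integrable0.
case Pi : (P i); last by under eq_fun do rewrite big_cons Pi.
by under eq_fun do rewrite big_cons Pi; apply: cintegrableD => //; exact: iF.
Qed.

Lemma cintegral_sum (I : Type) (r : seq I) (P : pred I) (F : I -> T -> C) :
  (forall i, P i -> cintegrable (F i)) ->
  cintegral (fun x => \sum_(i <- r | P i) F i x) = \sum_(i <- r | P i) cintegral (F i).
Proof.
move=> iF; elim: r => [|i r IH].
  rewrite big_nil; under eq_cintegral do rewrite big_nil.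
  by apply: complex_eqP; rewrite /= Rintegral_cst // mul0r.
rewrite big_cons; case Pi : (P i); under eq_cintegral do rewrite big_cons Pi; last by [].
by rewrite cintegralD ?IH //; [exact: iF|exact: cintegrable_sum].
Qed.

Lemma cintegral_cst c : cintegral (cst c) = creal (fine (mu D)) * c.
Proof.
by apply: complex_eqP; rewrite ?rpart_crealM ?ipartM ?mul0r ?addr0 /= Rintegral_cst // mulrC.
Qed.

Lemma bounded_cintegrable f (M : C) : (mu D < +oo)%E ->
  measurable_fun D (rpart \o f) -> measurable_fun D (ipart \o f) ->
  (forall x, D x -> `|f x| <= M) -> cintegrable f.
Proof.
move=> muD mr mi fM; split; apply: measurable_bounded_integrable => //;
  exists (rpart M); split; rewrite ?num_real // => B MB x /fM Mfx /=.
  exact: le_trans (norm_rpart_le Mfx) (ltW MB).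
exact: le_trans (norm_ipart_le Mfx) (ltW MB).
Qed.

End complex_integral.

Section borel_matrices.
Context {R : realType}.
Local Notation C := (Cplx R).

Lemma open_borelM m n (A : set 'M[C]_(m, n)) : open A ->
  measurable (A : set (borelM R m n)).
Proof. by move=> oA; exact: sub_sigma_algebra. Qed.

Lemma closed_borelM m n (A : set 'M[C]_(m, n)) : closed A ->
  measurable (A : set (borelM R m n)).
Proof.
by move=> cA; rewrite -(setCK A); apply: measurableC; apply: open_borelM; exact: closed_openC.
Qed.

Lemma continuous_borelM_real m n (f : 'M[C]_(m, n) -> R) : continuous f ->
  measurable_fun setT (f : borelM R m n -> R).
Proof.
move=> /continuousP cf.
apply: (measurability _ (RGenOInfty.measurableE R)) => _ [_ [x ->] <-].
by rewrite setTI; apply: open_borelM; apply: cf; exact: interval_open.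
Qed.

Lemma continuous_borelM m n m' n' (f : 'M[C]_(m, n) -> 'M[C]_(m', n')) :
  continuous f -> measurable_fun setT (f : borelM R m n -> borelM R m' n').
Proof.
move=> /continuousP cf.
apply: (measurability (rT := borelM R m' n') open) => // _ [B oB <-].
by rewrite setTI; apply: open_borelM; exact: cf.
Qed.

Lemma mx_continuous (T : topologicalType) m n (f : T -> 'M[C]_(m, n)) :
  (forall i j, continuous (fun x => f x i j)) -> continuous f.
Proof.
move=> cf x A [B nB sBA]; apply: filterS sBA _ => /=.
apply: filter_forall => i; apply: filter_forall => j.
exact: cf (nB i j).
Qed.

Lemma sum_continuous (T : topologicalType) (I : Type) (r : seq I) (P : pred I)
    (F : I -> T -> C) :
  (forall i, continuous (F i)) ->
  continuous (fun x => \sum_(i <- r | P i) F i x : C).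
Proof. by move=> cF; apply: continuous_big => [|i _]; [exact: add_continuous|exact: cF]. Qed.

Lemma addr_continuous (T : topologicalType) (f g : T -> C) :
  continuous f -> continuous g -> continuous (fun x => f x + g x : C).
Proof. by move=> cf cg x; apply: cvgD; [exact: cf|exact: cg]. Qed.

Lemma mulr_continuous (T : topologicalType) (f g : T -> C) :
  continuous f -> continuous g -> continuous (fun x => f x * g x : C).
Proof. by move=> cf cg x; apply: cvgM; [exact: cf|exact: cg]. Qed.

Lemma entry_continuous m n i j : continuous (fun A : 'M[C]_(m, n) => A i j).
Proof. exact: (coord_continuous (K := C)). Qed.

Lemma mx_entry_continuous (T : topologicalType) m n (f : T -> 'M[C]_(m, n)) i j :
  continuous f -> continuous (fun x => f x i j).
Proof.
move=> cf x; apply: (@continuous_comp _ _ _ f (fun A => A i j)); first exact: cf.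
exact: entry_continuous.
Qed.

Lemma conj_entry_continuous m n i j : continuous (fun A : 'M[C]_(m, n) => (A i j)^*).
Proof.
by move=> A; apply: continuous_comp; [exact: entry_continuous|exact: conj_continuous].
Qed.

Lemma mulmx_continuous (T : topologicalType) m n p
    (f : T -> 'M[C]_(m, n)) (g : T -> 'M[C]_(n, p)) :
  continuous f -> continuous g -> continuous (fun x => f x *m g x).
Proof.
move=> cf cg; apply: mx_continuous => i j; under eq_fun do rewrite mxE.
by apply: sum_continuous => k; apply: mulr_continuous; exact: mx_entry_continuous.
Qed.

Lemma conjmx_continuous m n : continuous (fun A : 'M[C]_(m, n) => A^t* : 'M[C]_(n, m)).
Proof.
by apply: mx_continuous => i j; under eq_fun do rewrite !mxE; exact: conj_entry_continuous.
Qed.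

Lemma closed_fiber (T : topologicalType) (f : T -> C) c :
  continuous f -> closed [set x | f x = c].
Proof.
move=> cf; apply: (@closed_comp _ _ f [set c]); first by move=> x _; exact: cf.
by apply/accessible_closed_set1/hausdorff_accessible/norm_hausdorff.
Qed.

End borel_matrices.

(** * Expectations on the unit sphere *)

Section sphere_expectation.
Context {R : realType} (N : nat) (nu : probability (borelM R N 1) R).
Local Notation C := (Cplx R).
Local Notation sphere := (@unit_sphere R N).
Hypothesis nu_uniform : uniform_on_sphere nu.
Implicit Types f g : 'cV[C]_N -> C.

Definition bounded_continuous f :=
  continuous f /\ exists M : C, forall x, sphere x -> `|f x| <= M.

Definition expect f : C := cintegral nu (sphere : set (borelM R N 1)) f.

Lemma closed_sphere : closed sphere.
Proof.
apply: closed_fiber; apply: sum_continuous => i; under eq_fun do rewrite normCK.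
by apply: mulr_continuous; [exact: entry_continuous|exact: conj_entry_continuous].
Qed.

Lemma measurable_sphere : measurable (sphere : set (borelM R N 1)).
Proof. exact: closed_borelM closed_sphere. Qed.

Lemma bounded_continuous_cst c : bounded_continuous (cst c).
Proof. by split; [exact: cst_continuous|exists `|c|]. Qed.

Lemma bounded_continuousD f g : bounded_continuous f -> bounded_continuous g ->
  bounded_continuous (fun x => f x + g x).
Proof.
move=> [cf [K fK]] [cg [L gL]]; split; first exact: addr_continuous cf cg.
exists (K + L) => x Sx; apply: le_trans (ler_normD _ _) _.
by apply: lerD; [exact: fK|exact: gL].
Qed.

Lemma bounded_continuousM f g : bounded_continuous f -> bounded_continuous g ->
  bounded_continuous (fun x => f x * g x).
Proof.
move=> [cf [K fK]] [cg [L gL]]; split; first exact: mulr_continuous cf cg.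
by exists (K * L) => x Sx; rewrite normrM ler_pM // ?fK ?gL.
Qed.

Lemma bounded_continuousZ c f : bounded_continuous f ->
  bounded_continuous (fun x => c * f x).
Proof. by apply: bounded_continuousM; exact: bounded_continuous_cst. Qed.

Lemma bounded_continuous_conj f : bounded_continuous f ->
  bounded_continuous (fun x => (f x)^*).
Proof.
move=> [cf [K fK]]; split; last by exists K => x Sx; rewrite norm_conjC fK.
by move=> x; apply: continuous_comp; [exact: cf|exact: conj_continuous].
Qed.

Lemma bounded_continuous_big (op : C -> C -> C) (z : C) (I : Type) (r : seq I) (P : pred I) F :
  (forall f g, bounded_continuous f -> bounded_continuous g ->
    bounded_continuous (fun x => op (f x) (g x))) ->
  (forall i, P i -> bounded_continuous (F i)) ->
  bounded_continuous (fun x => \big[op/z]_(i <- r | P i) F i x).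
Proof.
move=> b_op bF; elim: r => [|i r IH].
  under eq_fun do rewrite big_nil; exact: bounded_continuous_cst.
case Pi : (P i); last by under eq_fun do rewrite big_cons Pi.
by under eq_fun do rewrite big_cons Pi; apply: b_op => //; exact: bF.
Qed.

Lemma bounded_continuous_sum (I : Type) (r : seq I) (P : pred I) F :
  (forall i, P i -> bounded_continuous (F i)) ->
  bounded_continuous (fun x => \sum_(i <- r | P i) F i x).
Proof. exact: bounded_continuous_big bounded_continuousD. Qed.

Lemma bounded_continuous_prod (I : Type) (r : seq I) (P : pred I) F :
  (forall i, P i -> bounded_continuous (F i)) ->
  bounded_continuous (fun x => \prod_(i <- r | P i) F i x).
Proof. exact: bounded_continuous_big bounded_continuousM. Qed.

Lemma bounded_continuous_coord i : bounded_continuous (fun x => x i 0).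
Proof.
split; first exact: entry_continuous.
exists 1 => x Sx; rewrite -(@ler_pXn2r _ 2) ?nnegrE //.
by rewrite expr1n -[leRHS]Sx (bigD1 i) //= lerDl sumr_ge0 // => j _; exact: exprn_ge0.
Qed.

Lemma bounded_continuous_cintegrable f : bounded_continuous f ->
  cintegrable nu (sphere : set (borelM R N 1)) f.
Proof.
move=> [cf [M fM]]; apply: (bounded_cintegrable measurable_sphere (M := M)) => //.
- by rewrite (le_lt_trans (probability_le1 _ measurable_sphere)) ?ltry.
- apply: measurable_funTS; apply: continuous_borelM_real => x.
  by apply: continuous_comp; [exact: cf|exact: rpart_continuous].
apply: measurable_funTS; apply: continuous_borelM_real => x.
by apply: continuous_comp; [exact: cf|exact: ipart_continuous].
Qed.

Lemma eq_expect f g : (forall x, sphere x -> f x = g x) -> expect f = expect g.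
Proof. exact: (@eq_cintegral _ (borelM R N 1)). Qed.

Lemma expectD f g : bounded_continuous f -> bounded_continuous g ->
  expect (fun x => f x + g x) = expect f + expect g.
Proof.
by move=> bf bg; apply: cintegralD; first exact: measurable_sphere;
  exact: bounded_continuous_cintegrable.
Qed.

Lemma expectZ c f : bounded_continuous f -> expect (fun x => c * f x) = c * expect f.
Proof.
by move=> bf; apply: cintegralZ; [exact: measurable_sphere|exact: bounded_continuous_cintegrable].
Qed.

Lemma expect_sum (I : Type) (r : seq I) (P : pred I) F :
  (forall i, P i -> bounded_continuous (F i)) ->
  expect (fun x => \sum_(i <- r | P i) F i x) = \sum_(i <- r | P i) expect (F i).
Proof.
move=> bF; apply: cintegral_sum; first exact: measurable_sphere.
by move=> i /bF; exact: bounded_continuous_cintegrable.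
Qed.

Lemma expect_cst c : expect (cst c) = c.
Proof.
rewrite /expect cintegral_cst; last exact: measurable_sphere.
have nu1 : nu sphere = 1%E := nu_uniform.1.
by rewrite [X in fine X]nu1 rmorph1 mul1r.
Qed.

Lemma unitary_sphere (U : 'M[C]_N) (x : 'cV[C]_N) : U \is unitarymx ->
  sphere (U *m x) <-> sphere x.
Proof.
move=> /unitarymxP UU; have {}UU : U^t* *m U = 1%:M by exact: mulmx1C.
have normE (y : 'cV[C]_N) : \sum_(i < N) `|y i 0| ^+ 2 = (y^t* *m y) 0 0.
  by rewrite mxE; apply: eq_bigr => i _; rewrite !mxE normCK mulrC.
by rewrite /unit_sphere /= !normE trmx_mul map_mxM mulmxA -(mulmxA _ _ U) UU mulmx1.
Qed.

Lemma mulmxl_continuous (U : 'M[C]_N) : continuous (fun x : 'cV[C]_N => U *m x).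
Proof. by apply: mulmx_continuous => x; [exact: cst_continuous|exact: cvg_id]. Qed.

Lemma bounded_continuous_unitary (U : 'M[C]_N) f : U \is unitarymx ->
  bounded_continuous f -> bounded_continuous (fun x => f (U *m x)).
Proof.
move=> Uu [cf [M fM]]; split; last by exists M => x Sx; apply: fM; apply/unitary_sphere.
by move=> x; apply: continuous_comp; [exact: mulmxl_continuous|exact: cf].
Qed.

Lemma expect_unitary (U : 'M[C]_N) f : U \is unitarymx -> bounded_continuous f ->
  expect (fun x => f (U *m x)) = expect f.
Proof.
move=> Uu bf; have mU := continuous_borelM (mulmxl_continuous (U := U)).
have [ir ii] := bounded_continuous_cintegrable (bounded_continuous_unitary Uu bf).
have sphereU : sphere = (fun x : 'cV[C]_N => U *m x) @^-1` sphere.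
  by apply/seteqP; split => x /(unitary_sphere x Uu).
have inv (h : 'cV[C]_N -> R) : continuous h ->
    nu.-integrable (sphere : set (borelM R N 1)) (EFin \o (fun x => h (U *m x))) ->
    \int[nu]_(x in sphere) h (U *m x) = \int[nu]_(x in sphere) h x.
  move=> ch ih; congr fine.
  have := @integral_pushforward _ _ _ _ R _ mU nu (sphere : set (borelM R N 1)) (EFin \o h).
  rewrite -sphereU => <- //; last 2 first.
  - by apply/measurable_EFinP; exact: continuous_borelM_real.
  - exact: measurable_sphere.
  by apply: eq_measure_integral => A mA _; exact: nu_uniform.2.
case: bf => cf _; congr Complex.
  by apply: (inv (rpart \o f)) => // x; apply: continuous_comp; [exact: cf|exact: rpart_continuous].
by apply: (inv (ipart \o f)) => // x; apply: continuous_comp; [exact: cf|exact: ipart_continuous].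
Qed.

Lemma uniform_measure_le_expect (S : set (borelM R N 1)) f :
  measurable S -> bounded_continuous f ->
  (forall x, 0 <= rpart (f x)) -> (forall x, S x -> 1 <= rpart (f x)) ->
  (nu S <= (rpart (expect f))%:E)%E.
Proof.
move=> mS bf f_ge0 f_ge1; have mD := measurable_sphere.
have [fi _] := bounded_continuous_cintegrable bf.
pose D : set (borelM R N 1) := sphere.
have mSD : measurable (S `&` D) by exact: measurableI.
have nuDC : nu (~` D) = 0%E.
  have nuD : nu D = 1%E := nu_uniform.1.
  by rewrite [LHS](probability_setC nu mD) [X in (1 - X)%E]nuD subee.
have nuSD : (nu S <= nu (S `&` D))%E.
  rewrite -[leRHS]adde0 -nuDC; apply: le_trans (measureU2 _ _ _) => //; last exact: measurableC.
  apply: le_measure; rewrite ?inE //; first by apply: measurableU => //; exact: measurableC.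
  by move=> x Sx; case: (pselect (D x)) => Dx; [left|right].
apply: le_trans nuSD _; rewrite /= fineK ?integrable_fin_num //.
rewrite -[leLHS]mul1e -(integral_cst _ mSD).
apply: (@le_trans _ _ (\int[nu]_(x in S `&` D) (rpart (f x))%:E)%E).
  apply: ge0_le_integral => // [|x [Sx _]]; last by rewrite lee_fin f_ge1.
  apply: measurable_funS mD _ _; first exact: subIsetr.
  exact: measurable_int fi.
apply: ge0_subset_integral => [|||x _|] //; last by rewrite lee_fin f_ge0.
exact: measurable_int fi.
Qed.

End sphere_expectation.

(** * Schwinger-Dyson equations *)

(* The points are the images of the natural numbers under the Cayley map. *)
Lemma eq_poly_unit_circle (K : numClosedFieldType) (p q : {poly K}) :
  (forall w, w * w^* = 1 -> p.[w] = q.[w]) -> p = q.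
Proof.
move=> pq; pose den (n : nat) : K := 1 - 'i * n%:R; pose cayley n := (den n)^* / den n.
have conj_den n : (den n)^* = 1 + 'i * n%:R.
  by rewrite rmorphB rmorph1 rmorphM /= conjCi conjC_nat mulNr opprK.
have den_neq0 n : den n != 0.
  rewrite -normr_eq0 -sqrf_eq0 normCK conj_den -subr_sqr expr1n exprMn sqrCi mulN1r opprK.
  by rewrite gt_eqF // ltr_wpDr // ?exprn_ge0 ?ler0n.
have cayley_circle n : cayley n * (cayley n)^* = 1.
  by rewrite rmorphM fmorphV /= conjCK mulrA divfK ?divff // conjC_eq0.
have cayley_inj : injective cayley.
  move=> m n /eqP; rewrite eqr_div // !conj_den /den -subr_eq0.
  have -> : (1 + 'i * m%:R) * (1 - 'i * n%:R) - (1 + 'i * n%:R) * (1 - 'i * m%:R) =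
    2 * 'i * (m%:R - n%:R) :> K by ring.
  by rewrite !mulf_eq0 pnatr_eq0 (negbTE (neq0Ci K)) subr_eq0 eqr_nat /= => /eqP.
apply/eqP; rewrite -subr_eq0; apply/eqP.
apply: (@roots_geq_poly_eq0 _ _ [seq cayley n | n <- iota 0 (size (p - q))]).
- by apply/allP => _ /mapP[n _ ->]; rewrite /root hornerD hornerN pq ?subrr.
- by rewrite map_inj_uniq ?iota_uniq.
- by rewrite size_map size_iota.
Qed.

Section subset_expansion.
Variables (K : comNzRingType) (S : finType).
Implicit Types (a b : S -> K) (J : {set S}).

Definition subset_prod a b J : K := \prod_s (if s \in J then b s else a s).

Lemma prod_affine a b w :
  \prod_s (a s + w * b s) = \sum_(J : {set S}) w ^+ #|J| * subset_prod a b J.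
Proof.
rewrite (eq_bigr (fun s => w * b s + a s)) => [|s _]; last by rewrite addrC.
rewrite bigA_distr; apply: eq_bigr => J _.
rewrite -prodr_const [X in X * _]big_mkcond -big_split /=.
by apply: eq_bigr => s _; case: ifP; rewrite ?mul1r.
Qed.

(* The derivative of [prod_affine] at [w = 1]. *)
Lemma sum_card_subset_prod a b :
  \sum_(J : {set S}) #|J|%:R * subset_prod a b J =
  \sum_s b s * \prod_(t | t != s) (a t + b t).
Proof.
transitivity (\sum_s \sum_(J : {set S} | s \in J) subset_prod a b J).
  rewrite [RHS](exchange_big_dep predT) //=; apply: eq_bigr => J _.
  by rewrite sumr_const mulr_natl.
apply: eq_bigr => s _; pose a' t := if t == s then 0 else a t.
have := prod_affine a' b 1; rewrite (bigD1 s) //= /a' eqxx mul1r add0r.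
under eq_bigr => t ts do rewrite (negbTE ts) mul1r.
move=> ->; under [RHS]eq_bigr do rewrite expr1n mul1r.
rewrite [RHS](bigID (fun J : {set S} => s \in J)) /= [X in _ + X]big1 ?addr0 => [|J sJ].
  apply: eq_bigr => J sJ; apply: eq_bigr => t _; case: ifP => // tJ.
  by case: eqP tJ => // ->; rewrite sJ.
by rewrite /subset_prod (bigD1 s) //= (negbTE sJ) eqxx mul0r.
Qed.

End subset_expansion.

Lemma unitary_pencil (K : numClosedFieldType) n (P : 'M[K]_n) (w : K) :
  P^t* = P -> P *m P = P -> w * w^* = 1 -> 1%:M - P + w *: P \is unitarymx.
Proof.
move=> P_herm P_idem ww; have -> : 1%:M - P + w *: P = 1%:M + (w - 1) *: P.
  by rewrite scalerBl scale1r addrA addrAC.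
apply/unitarymxP; rewrite linearD linearZ /= map_mxD map_mxZ trmx1 map_mx1 P_herm.
rewrite mulmxDl !mulmxDr !mul1mx mulmx1 -scalemxAl -scalemxAr P_idem scalerA.
rewrite -addrA -!scalerDl [X in X *: P](_ : _ = 0) ?scale0r ?addr0 //.
by rewrite rmorphB rmorph1 /= mulrBl mulrBr ww mulr1 mul1r; ring.
Qed.

Section matrix_functionals.
Variables (K : numClosedFieldType) (n : nat) (D : {scalar 'M[K]_n}).

Lemma scalar_eq0_rank1 : (forall u : 'cV[K]_n, D (u *m u^t*) = 0) -> forall G, D G = 0.
Proof.
move=> D0; pose B (u v : 'cV[K]_n) := D (u *m v^t*).
have polar w u v : B (u + w *: v) (u + w *: v) = 0 -> w^* * B u v + w * B v u = 0.
  rewrite /B linearD /= map_mxD linearZ /= map_mxZ mulmxDl !mulmxDr.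
  rewrite -!scalemxAl -!scalemxAr !linearD !linearZ /= !D0 !mulr0 add0r addr0.
  by rewrite addrC.
have B0 u v : B u v = 0.
  have e1 := polar 1 u v (D0 _); have ei := polar 'i u v (D0 _).
  rewrite conjC1 !mul1r in e1; rewrite conjCi in ei.
  have /eqP : 2 * 'i * B u v = 0.
    have -> : 2 * 'i * B u v = 'i * (B u v + B v u) - (- 'i * B u v + 'i * B v u) by ring.
    by rewrite e1 ei mulr0 subr0.
  by rewrite !mulf_eq0 pnatr_eq0 (negbTE (neq0Ci K)) => /eqP.
move=> G; rewrite (matrix_sum_delta G) linear_sum big1 // => i _.
rewrite linear_sum big1 // => j _; rewrite linearZ /=.
have -> : delta_mx i j = delta_mx i 0 *m (delta_mx j 0 : 'cV[K]_n)^t*.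
  by rewrite trmx_delta map_delta_mx mul_delta_mx.
by rewrite [D _]B0 mulr0.
Qed.

Lemma scalar_eq0_proj : (forall P, P^t* = P -> P *m P = P -> D P = 0) ->
  forall G, D G = 0.
Proof.
move=> D0; apply: scalar_eq0_rank1 => u.
have [->|u0] := eqVneq u 0; first by rewrite mul0mx linear0.
pose c := (u^t* *m u) 0 0; have uuE : u^t* *m u = c%:M by exact: mx11_scalar.
have cE : c = \sum_i `|u i 0| ^+ 2.
  by rewrite /c mxE; apply: eq_bigr => i _; rewrite !mxE normCK mulrC.
have c0 : c != 0.
  apply: contraNneq u0 => c0; apply/eqP/colP => i; rewrite mxE.
  have /eqP := c0; rewrite cE psumr_eq0 => [|j _]; last exact: exprn_ge0.
  by move/allP/(_ i (mem_index_enum i)); rewrite sqrf_eq0 normr_eq0 => /eqP.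
have c_real : c^* = c.
  by rewrite cE rmorph_sum; apply: eq_bigr => i _; rewrite rmorphXn /= conj_normC.
have /eqP : D (c^-1 *: (u *m u^t*)) = 0.
  apply: D0.
    by rewrite linearZ /= map_mxZ fmorphV /= c_real trmx_mul map_mxM trmxCK.
  rewrite -scalemxAl -scalemxAr scalerA mulmxA -(mulmxA u) uuE mul_mx_scalar.
  by rewrite -scalemxAl scalerA divfK.
by rewrite linearZ /= mulf_eq0 invr_eq0 (negbTE c0) => /eqP.
Qed.

End matrix_functionals.

Section schwinger_dyson.
Context {R : realType} (N : nat) (nu : probability (borelM R N 1) R).
Local Notation C := (Cplx R).
Hypothesis nu_uniform : uniform_on_sphere nu.
Local Notation E := (expect nu).

Lemma expect_prod_affine (S : finType) (a b : S -> 'cV[C]_N -> C) k c :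
  (forall s, bounded_continuous (a s)) -> (forall s, bounded_continuous (b s)) ->
  (forall w, w * w^* = 1 -> E (fun x => \prod_s (a s x + w * b s x)) = w ^+ k * c) ->
  \sum_s E (fun x => b s x * \prod_(t | t != s) (a t x + b t x)) = k%:R * c.
Proof.
move=> ba bb E_circle; pose m (J : {set S}) x := subset_prod (a^~ x) (b^~ x) J.
have bm J : bounded_continuous (m J).
  by apply: bounded_continuous_prod => s _; case: (s \in J).
have E_poly : \sum_(J : {set S}) E (m J) *: 'X^#|J| = c *: 'X^k.
  apply: eq_poly_unit_circle => w /E_circle; rewrite hornerZ hornerXn mulrC => <-.
  under eq_expect do rewrite prod_affine.
  rewrite expect_sum => [|J _]; last exact: bounded_continuousZ (bm J).
  rewrite horner_sum; apply: eq_bigr => J _.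
  by rewrite hornerZ hornerXn (expectZ nu _ (bm J)) mulrC.
have := congr1 (fun p => p^`().[1]) E_poly.
rewrite derivZ derivXn hornerZ hornerMn hornerXn expr1n mulrC => <-.
rewrite raddf_sum horner_sum /= -expect_sum => [|s _]; last first.
  apply: bounded_continuousM => //; apply: bounded_continuous_prod => t _.
  exact: bounded_continuousD.
under eq_expect do rewrite -sum_card_subset_prod.
rewrite expect_sum => [|J _]; last exact: bounded_continuousZ (bm J).
apply: eq_bigr => J _.
by rewrite derivZ derivXn hornerZ hornerMn hornerXn expr1n (expectZ nu _ (bm J)) mulrC.
Qed.

Variable S : finType.
Implicit Types (e f : S -> 'I_N) (A B : {set S}).

Definition mono e f A B (x : 'cV[C]_N) : C :=
  \prod_(s in A) x (e s) 0 * \prod_(s in B) (x (f s) 0)^*.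

Lemma mono_bounded e f A B : bounded_continuous (mono e f A B).
Proof.
apply: bounded_continuousM; apply: bounded_continuous_prod => s _.
  exact: bounded_continuous_coord.
by apply: bounded_continuous_conj; exact: bounded_continuous_coord.
Qed.

Lemma mono_setD1r e f A B s x : s \in B ->
  mono e f A B x = (x (f s) 0)^* * mono e f A (B :\ s) x.
Proof. by move=> sB; rewrite /mono (big_setD1 s sB) /= mulrCA. Qed.

Lemma bounded_continuous_mulmx (G : 'M[C]_N) i : bounded_continuous (fun x => (G *m x) i 0).
Proof.
under eq_fun do rewrite mxE; apply: bounded_continuous_sum => j _.
by apply: bounded_continuousZ; exact: bounded_continuous_coord.
Qed.

(* The derivative of [E (mono e f A B (exp (h *: G) *m x))] at [h = 0], for a
   skew-Hermitian [G]. *)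
Definition derivation e f A B (G : 'M[C]_N) : C :=
  \sum_(s in A) E (fun x => (G *m x) (e s) 0 * mono e f (A :\ s) B x) -
  \sum_(s in B) E (fun x => ((G^t* *m x) (f s) 0)^* * mono e f A (B :\ s) x).

Lemma bounded_holomorphic_term e f A B s (G : 'M[C]_N) i :
  bounded_continuous (fun x => (G *m x) i 0 * mono e f (A :\ s) B x).
Proof. by apply: bounded_continuousM; [exact: bounded_continuous_mulmx|exact: mono_bounded]. Qed.

Lemma bounded_antiholomorphic_term e f A B s (G : 'M[C]_N) i :
  bounded_continuous (fun x => ((G *m x) i 0)^* * mono e f A (B :\ s) x).
Proof.
apply: bounded_continuousM; last exact: mono_bounded.
by apply: bounded_continuous_conj; exact: bounded_continuous_mulmx.
Qed.

Fact derivation_is_scalar e f A B : scalar (derivation e f A B).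
Proof.
have E_lin c (g h : 'cV[C]_N -> C) : bounded_continuous g -> bounded_continuous h ->
    E (fun x => c * g x + h x) = c * E g + E h.
  move=> bg bh; rewrite -(expectZ nu c bg).
  by rewrite (expectD nu (bounded_continuousZ c bg) bh).
move=> c G H; rewrite /derivation mulrBr !mulr_sumr addrACA -opprD -!big_split /=.
congr (_ - _); apply: eq_bigr => s _; rewrite -E_lin;
  do ?[exact: bounded_holomorphic_term | exact: bounded_antiholomorphic_term].
  by apply: eq_expect => x _; rewrite mulmxDl -scalemxAl mxE [X in X + _]mxE mulrDl mulrA.
apply: eq_expect => x _; rewrite linearD linearZ /= map_mxD map_mxZ mulmxDl -scalemxAl.
by rewrite mxE [X in X + _]mxE rmorphD rmorphM /= conjCK mulrDl mulrA.
Qed.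

HB.instance Definition _ e f A B :=
  GRing.isLinear.Build C 'M[C]_N C *%R (derivation e f A B) (derivation_is_scalar e f A B).

Section projection_pencil.
Variables (e f : S -> 'I_N) (A B : {set S}) (P : 'M[C]_N).
Hypotheses (P_herm : P^t* = P) (P_idem : P *m P = P).
Local Notation Q := (1%:M - P).

Let QxE (x : 'cV[C]_N) i : (Q *m x) i 0 = x i 0 - (P *m x) i 0.
Proof. by rewrite mulmxBl mul1mx !mxE. Qed.

Definition pencil_const (u : S + S) (x : 'cV[C]_N) : C :=
  match u with
  | inl s => if s \in A then (Q *m x) (e s) 0 else 1
  | inr s => if s \in B then ((P *m x) (f s) 0)^* else 1
  end.

Definition pencil_slope (u : S + S) (x : 'cV[C]_N) : C :=
  match u with
  | inl s => if s \in A then (P *m x) (e s) 0 else 0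
  | inr s => if s \in B then ((Q *m x) (f s) 0)^* else 0
  end.

(* The powers of [w] clear the conjugates [w^* = w^-1]. *)
Lemma prod_pencil w x : w * w^* = 1 ->
  \prod_u (pencil_const u x + w * pencil_slope u x) =
  w ^+ #|B| * mono e f A B ((Q + w *: P) *m x).
Proof.
move=> ww; have pencilE i : ((Q + w *: P) *m x) i 0 = (Q *m x) i 0 + w * (P *m x) i 0.
  by rewrite mulmxDl -scalemxAl mxE [X in _ + X]mxE.
rewrite big_sumType /= mulrCA; congr (_ * _).
  rewrite [RHS]big_mkcond; apply: eq_bigr => s _.
  by case: ifP => _; [rewrite pencilE|rewrite mulr0 addr0].
rewrite -prodr_const -big_split [RHS]big_mkcond; apply: eq_bigr => s _.
case: ifP => _; last by rewrite mulr0 addr0.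
by rewrite pencilE rmorphD rmorphM /= mulrDr mulrA ww mul1r addrC.
Qed.

Lemma pencil_at1 u x : pencil_const u x + pencil_slope u x =
  match u with
  | inl s => if s \in A then x (e s) 0 else 1
  | inr s => if s \in B then (x (f s) 0)^* else 1
  end.
Proof.
case: u => s /=; case: ifP => _; rewrite ?addr0 // QxE ?subrK //.
by rewrite rmorphB /= addrC subrK.
Qed.

Lemma prod_pencil_neq_inl s x :
  \prod_(u | u != inl s) (pencil_const u x + pencil_slope u x) = mono e f (A :\ s) B x.
Proof.
under eq_bigr do rewrite pencil_at1.
rewrite big_sumType /= -[X in _ * X]big_mkcond; congr (_ * _).
by rewrite -big_mkcondr; apply: eq_bigl => t; rewrite in_setD1.
Qed.

Lemma prod_pencil_neq_inr s x :
  \prod_(u | u != inr s) (pencil_const u x + pencil_slope u x) = mono e f A (B :\ s) x.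
Proof.
under eq_bigr do rewrite pencil_at1.
rewrite big_sumType /= -[X in X * _]big_mkcond; congr (_ * _).
by rewrite -big_mkcondr; apply: eq_bigl => t; rewrite in_setD1.
Qed.

Lemma bounded_pencil_const u : bounded_continuous (pencil_const u).
Proof.
case: u => s; rewrite /pencil_const; [case: (s \in A)|case: (s \in B)];
  try exact: bounded_continuous_cst.
- exact: bounded_continuous_mulmx.
- by apply: bounded_continuous_conj; exact: bounded_continuous_mulmx.
Qed.

Lemma bounded_pencil_slope u : bounded_continuous (pencil_slope u).
Proof.
case: u => s; rewrite /pencil_slope; [case: (s \in A)|case: (s \in B)];
  try exact: bounded_continuous_cst.
- exact: bounded_continuous_mulmx.
- by apply: bounded_continuous_conj; exact: bounded_continuous_mulmx.
Qed.

Lemma derivation_proj : derivation e f A B P = 0.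
Proof.
have := expect_prod_affine bounded_pencil_const bounded_pencil_slope (k := #|B|)
  (c := E (mono e f A B)); rewrite big_sumType /=.
have -> : \sum_s E (fun x => (if s \in A then (P *m x) (e s) 0 else 0) *
      \prod_(u | u != inl s) (pencil_const u x + pencil_slope u x)) =
    \sum_(s in A) E (fun x => (P *m x) (e s) 0 * mono e f (A :\ s) B x).
  rewrite [RHS]big_mkcond; apply: eq_bigr => s _; case: ifP => _.
    by apply: eq_expect => x _; rewrite prod_pencil_neq_inl.
  by rewrite -[RHS](expect_cst nu_uniform 0); apply: eq_expect => x _; rewrite mul0r.
have -> : \sum_s E (fun x => (if s \in B then ((Q *m x) (f s) 0)^* else 0) *
      \prod_(u | u != inr s) (pencil_const u x + pencil_slope u x)) =
    \sum_(s in B) (E (mono e f A B) -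
      E (fun x => ((P *m x) (f s) 0)^* * mono e f A (B :\ s) x)).
  rewrite [RHS]big_mkcond; apply: eq_bigr => s _; case: ifP => [sB|_]; last first.
    by rewrite -[RHS](expect_cst nu_uniform 0); apply: eq_expect => x _; rewrite mul0r.
  have bP := bounded_antiholomorphic_term e f A B s P (f s).
  rewrite -[- E _]mulN1r -(expectZ nu _ bP).
  rewrite -(expectD nu (mono_bounded e f A B) (bounded_continuousZ _ bP)).
  apply: eq_expect => x _; rewrite prod_pencil_neq_inr (mono_setD1r _ _ _ _ sB).
  by rewrite mulN1r -mulrBl QxE rmorphB.
have circle w : w * w^* = 1 -> E (fun x => \prod_u (pencil_const u x + w * pencil_slope u x)) =
    w ^+ #|B| * E (mono e f A B).
  move=> ww; have Uu := unitary_pencil P_herm P_idem ww.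
  rewrite -(expect_unitary nu_uniform Uu (mono_bounded e f A B)).
  rewrite -expectZ; last by apply: bounded_continuous_unitary => //; exact: mono_bounded.
  by apply: eq_expect => x _; rewrite prod_pencil.
move=> /(_ circle); rewrite big_split sumr_const sumrN /= mulr_natl => /eqP.
by rewrite addrCA -subr_eq0 addrAC subrr add0r /derivation P_herm => /eqP.
Qed.

End projection_pencil.

Lemma derivation_eq0 e f A B G : derivation e f A B G = 0.
Proof. by apply: scalar_eq0_proj => P; exact: derivation_proj. Qed.

(* [derivation_eq0] for the matrix unit [delta_mx c b]. *)
Lemma coordinate_exchange e f A B c b :
  \sum_(s in A | e s == c) E (fun x => x b 0 * mono e f (A :\ s) B x) =
  \sum_(s in B | f s == b) E (fun x => (x c 0)^* * mono e f A (B :\ s) x).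
Proof.
have delta_mulE i k (x : 'cV[C]_N) r : (delta_mx i k *m x) r 0 = (r == i)%:R * x k 0.
  rewrite mxE (bigD1 k) //= big1 => [|j jk]; first by rewrite mxE eqxx andbT addr0.
  by rewrite mxE (negbTE jk) andbF mul0r.
have E0 (h : 'cV[C]_N -> C) : (forall x, h x = 0) -> E h = 0.
  by move=> h0; rewrite -[RHS](expect_cst nu_uniform 0); apply: eq_expect => x _.
have holo s : E (fun x => (delta_mx c b *m x) (e s) 0 * mono e f (A :\ s) B x) =
    if e s == c then E (fun x => x b 0 * mono e f (A :\ s) B x) else 0.
  case: ifP => ec; last by apply: E0 => x; rewrite delta_mulE ec !mul0r.
  by apply: eq_expect => x _; rewrite delta_mulE ec mul1r.
have antiholo s : E (fun x => (((delta_mx c b)^t* *m x) (f s) 0)^* * mono e f A (B :\ s) x) =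
    if f s == b then E (fun x => (x c 0)^* * mono e f A (B :\ s) x) else 0.
  rewrite trmx_delta map_delta_mx.
  case: ifP => fb; last by apply: E0 => x; rewrite delta_mulE fb mul0r conjC0 mul0r.
  by apply: eq_expect => x _; rewrite delta_mulE fb mul1r.
rewrite 2!big_mkcondr /=; under eq_bigr do rewrite -holo; under [RHS]eq_bigr do rewrite -antiholo.
by apply/eqP; rewrite -subr_eq0; apply/eqP; exact: derivation_eq0.
Qed.

Section redirection.
Variables (e f : S -> 'I_N) (t : S).

Definition redirect b : S -> 'I_N := [eta f with t |-> b].
Arguments redirect : simpl never.

Lemma redirect_id b : redirect b t = b.
Proof. by rewrite /redirect /= eqxx. Qed.

Lemma redirect_neq b s : s != t -> redirect b s = f s.
Proof. by rewrite /redirect /= => /negbTE ->. Qed.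

Lemma mono_redirect_notin b A B x : t \notin B ->
  mono e (redirect b) A B x = mono e f A B x.
Proof.
move=> tB; congr (_ * _); apply: eq_bigr => s sB.
by rewrite redirect_neq //; apply: contraNneq tB => <-.
Qed.

Lemma mono_redirect b A B x : t \in B ->
  mono e (redirect b) A B x = (x b 0)^* * mono e f A (B :\ t) x.
Proof.
by move=> tB; rewrite (mono_setD1r _ _ _ _ tB) mono_redirect_notin ?setD11 // redirect_id.
Qed.

(* The term [s = t] contributes for every [b], a term [s != t] only for [b = f s]. *)
Lemma sum_redirect A B : t \in B ->
  \sum_b \sum_(s in B | redirect b s == b)
    E (fun x => (x (f t) 0)^* * mono e (redirect b) A (B :\ s) x) =
  (N + #|B|.-1)%:R * E (mono e f A B).
Proof.
move=> tB; transitivity (\sum_b (E (mono e f A B) +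
    \sum_(s in B :\ t | f s == b) E (mono e f A B))); last first.
  rewrite big_split /= sumr_const card_ord natrD mulrDl !mulr_natl; congr (_ + _).
  under eq_bigr do rewrite big_mkcondr /=.
  rewrite exchange_big /= (cardsD1 t B) tB /= -sumr_const; apply: eq_bigr => s _.
  by rewrite -big_mkcond (big_pred1 (f s)) // => b; rewrite eq_sym.
apply: eq_bigr => b _; rewrite (bigD1 t) /=; last by rewrite tB redirect_id /=.
congr (_ + _).
  apply: eq_expect => x _.
  by rewrite mono_redirect_notin ?setD11 // (mono_setD1r _ _ _ _ tB).
apply: eq_big => s; first rewrite !inE.
  by case: (eqVneq s t) => [_|st]; rewrite ?andbF // redirect_neq ?andbT.
case/andP => /andP[sB /eqP fsb] st; apply: eq_expect => x _; rewrite redirect_neq // in fsb.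
have tBs : t \in B :\ s by rewrite in_setD1 eq_sym st.
have sBt : s \in B :\ t by rewrite in_setD1 st.
rewrite mono_redirect // (mono_setD1r _ _ _ _ tB) (mono_setD1r _ _ _ _ sBt) fsb.
by congr (_ * (_ * mono _ _ _ _ _)); apply/setP => u; rewrite !inE andbCA.
Qed.

Lemma schwinger_dyson A B : t \in B ->
  (N + #|B|.-1)%:R * E (mono e f A B) =
  \sum_(s in A | e s == f t) E (mono e f (A :\ s) (B :\ t)).
Proof.
move=> tB; rewrite -sum_redirect //.
under eq_bigr do rewrite -coordinate_exchange.
rewrite exchange_big /=; apply: eq_bigr => s _.
rewrite -expect_sum => [|b _]; last first.
  by apply: bounded_continuousM; [exact: bounded_continuous_coord|exact: mono_bounded].
apply: eq_expect => x x_sphere.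
under eq_bigr do rewrite mono_redirect // mulrA -normCK.
by rewrite -mulr_suml x_sphere mul1r.
Qed.

End redirection.
End schwinger_dyson.

(** * Networks of a pair of permutations *)

Lemma card_porbits1 (S : finType) : #|porbits (1%g : {perm S})| = #|S|.
Proof.
rewrite /porbits card_imset // => x y /setP/(_ x).
rewrite porbit_id => /esym/porbitP[i ->].
by rewrite expg1n perm1.
Qed.

Section constrained_sums.
Variables (S : finType) (K : numFieldType).

Definition ffun_upd (X : finType) (s : S) (x : X) (i : {ffun S -> X}) : {ffun S -> X} :=
  [ffun u => if u == s then x else i u].

Lemma sum_ffun_eq_coord (X : finType) (s r : S) (F : {ffun S -> X} -> K) : (0 < #|X|)%N ->
  (forall i x, F (ffun_upd s x i) = F i) ->
  \sum_(i : {ffun S -> X} | i s == i r) F i =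
  #|X|%:R ^- (r != s) * \sum_(i : {ffun S -> X}) F i.
Proof.
move=> X0 Fs; have [->|rs] := eqVneq r s.
  by rewrite expr0 invr1 mul1r; apply: eq_bigl => i; rewrite eqxx.
rewrite expr1; have nX : #|X|%:R != 0 :> K by rewrite pnatr_eq0 -lt0n.
apply: (mulfI nX); rewrite mulVKf // mulr_natl -sumr_const.
rewrite [RHS](partition_big (fun i : {ffun S -> X} => i s) predT) //=.
apply: eq_bigr => x _.
rewrite [RHS](reindex_onto (ffun_upd s x) (fun i => ffun_upd s (i r) i)); last first.
  by move=> i /eqP ix; apply/ffunP => u; rewrite !ffunE; case: eqP => // ->.
apply: eq_big => [i|i _]; last by rewrite Fs.
rewrite !ffunE eqxx eqxx (negbTE rs) /=; apply/eqP/eqP => [irs|/ffunP/(_ s)].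
  by apply/ffunP => u; rewrite !ffunE; case: eqP => // ->.
by rewrite !ffunE eqxx => ->.
Qed.

Lemma sum_ffun3_eq_coord (X Y Z : finType) (s q r t : S)
    (F : {ffun S -> X} -> {ffun S -> Y} -> {ffun S -> Z} -> K) :
  (0 < #|X|)%N -> (0 < #|Y|)%N -> (0 < #|Z|)%N ->
  (forall x i j a, F (ffun_upd s x i) j a = F i j a) ->
  (forall y i j a, F i (ffun_upd s y j) a = F i j a) ->
  (forall z i j a, F i j (ffun_upd s z a) = F i j a) ->
  \sum_(i : {ffun S -> X}) \sum_(j : {ffun S -> Y}) \sum_(a : {ffun S -> Z})
    (if [&& i s == i q, j s == j r & a s == a t] then F i j a else 0) =
  #|X|%:R ^- (q != s) * #|Y|%:R ^- (r != s) * #|Z|%:R ^- (t != s) *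
    \sum_i \sum_j \sum_a F i j a.
Proof.
move=> X0 Y0 Z0 Fi Fj Fa.
transitivity (\sum_(i : {ffun S -> X} | i s == i q)
    \sum_(j : {ffun S -> Y} | j s == j r) \sum_(a : {ffun S -> Z} | a s == a t) F i j a).
  rewrite [RHS]big_mkcond; apply: eq_bigr => i _.
  case: (i s == _) => /=; last by rewrite big1 // => j _; rewrite big1.
  rewrite [RHS]big_mkcond; apply: eq_bigr => j _.
  by case: (j s == _) => /=; [rewrite -big_mkcond|rewrite big1].
rewrite sum_ffun_eq_coord // => [|i x]; last first.
  by apply: eq_bigr => j _; apply: eq_bigr => a _.
rewrite -!mulrA; congr (_ * _); rewrite !mulr_sumr; apply: eq_bigr => i _.
rewrite sum_ffun_eq_coord // => [|j y]; last by apply: eq_bigr => a _.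
rewrite !mulrA -mulrA; congr (_ * _); rewrite mulr_sumr; apply: eq_bigr => j _.
by rewrite sum_ffun_eq_coord.
Qed.

End constrained_sums.

Section network.
Context {R : realType} (m n p : nat).
Local Notation N := (m * n * p)%N.
Variable nu : probability (borelM R N 1) R.
Hypothesis nu_uniform : uniform_on_sphere nu.
Hypotheses (m_gt0 : (0 < m)%N) (n_gt0 : (0 < n)%N) (p_gt0 : (0 < p)%N).
Local Notation C := (Cplx R).
Local Notation E := (expect nu).

Definition cell (i : 'I_m) (j : 'I_n) (a : 'I_p) : 'I_N :=
  mxtens_index (mxtens_index (i, j), a).

Lemma cell_eq i j a i' j' a' :
  (cell i j a == cell i' j' a') = [&& i == i', j == j' & a == a'].
Proof.
apply/eqP/and3P => [e|[/eqP-> /eqP-> /eqP->] //].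
have e1 := congr1 (fun k => mxtens_unindex (@mxtens_unindex (m * n) p k).1) e.
have e2 := congr1 (fun k => (@mxtens_unindex (m * n) p k).2) e.
by move: e1 e2; rewrite !mxtens_indexK /= => -[-> ->] ->.
Qed.

Variable S : finType.
Implicit Types (A : {set S}) (g h : {perm S}) (s t : S).
Implicit Types (i : {ffun S -> 'I_m}) (j : {ffun S -> 'I_n}) (a : {ffun S -> 'I_p}).

(* Both factors share the index [a u], over which the partial trace sums. *)
Definition net_mono A g h i j a : 'cV[C]_N -> C :=
  mono (fun u => cell (i u) (j u) (a u))
       (fun u => cell (i (g u)) (j (h u)) (a u)) A A.

Definition net A g h : R :=
  \sum_i \sum_j \sum_a rpart (E (net_mono A g h i j a)).

Lemma net_mono_splice_upd A g h s t i j a :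
  let F := net_mono (A :\ s) (splice s t g) (splice s t h) in
  [/\ forall x, F (ffun_upd s x i) j a = F i j a,
      forall y, F i (ffun_upd s y j) a = F i j a &
      forall z, F i j (ffun_upd s z a) = F i j a].
Proof.
have off (X : finType) (x : X) (k : {ffun S -> X}) u :
  u != s -> ffun_upd s x k u = k u by move=> us; rewrite ffunE (negbTE us).
rewrite /net_mono /mono; split=> x; apply/funext => y;
  congr (_ * _); apply: eq_bigr => u /setD1P[us _]; rewrite ?off //;
  by rewrite splice_neq.
Qed.

Lemma net_mono_contract A g h s t i j a : t \in A -> s \in A ->
  i s = i (g t) -> j s = j (h t) -> a s = a t ->
  mono (fun u => cell (i u) (j u) (a u))
       (fun u => cell (i (g u)) (j (h u)) (a u)) (A :\ s) (A :\ t) =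
  net_mono (A :\ s) (splice s t g) (splice s t h) i j a :> ('cV[C]_N -> C).
Proof.
move=> tA sA ig jh at_; apply/funext => x; rewrite /net_mono /mono; congr (_ * _).
have swap (X : finType) (k : {ffun S -> X}) (q r v : S) :
    k q = k r -> k (tperm q r v) = k v.
  by move=> kqr; case: tpermP => [->|->|//].
rewrite (reindex_inj (@perm_inj _ (tperm s t))) /=; apply: eq_big => u.
  rewrite !inE; case: tpermP => [->|->|/eqP us /eqP ut].
  - by rewrite eqxx eqxx.
  - by rewrite sA tA eq_sym.
  - by rewrite us ut.
by move=> _; rewrite !spliceE !swap.
Qed.

Lemma net_mono_rec A g h t i j a : t \in A ->
  (N + #|A|.-1)%:R * rpart (E (net_mono A g h i j a)) =
  \sum_(s in A) if [&& i s == i (g t), j s == j (h t) & a s == a t] then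
    rpart (E (net_mono (A :\ s) (splice s t g) (splice s t h) i j a)) else 0.
Proof.
move=> tA; pose e u := cell (i u) (j u) (a u).
pose f u := cell (i (g u)) (j (h u)) (a u).
have /(congr1 rpart) := schwinger_dyson nu_uniform e f A tA.
rewrite -(rmorph_nat creal) rpart_crealM => ->.
rewrite raddf_sum big_mkcondr /=; apply: eq_bigr => s sA; rewrite cell_eq.
by case: and3P => // -[/eqP ig /eqP jh /eqP at_]; rewrite net_mono_contract.
Qed.

Lemma net_rec A g h t : t \in A ->
  (N + #|A|.-1)%:R * net A g h = \sum_(s in A)
    m%:R ^- (g t != s) * n%:R ^- (h t != s) * p%:R ^- (t != s) *
    net (A :\ s) (splice s t g) (splice s t h).
Proof.
move=> tA; rewrite /net mulr_sumr.
transitivity (\sum_(s in A) \sum_(i : {ffun S -> 'I_m}) \sum_(j : {ffun S -> 'I_n})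
    \sum_(a : {ffun S -> 'I_p}) if [&& i s == i (g t), j s == j (h t) & a s == a t] then
    rpart (E (net_mono (A :\ s) (splice s t g) (splice s t h) i j a)) else 0).
  rewrite [RHS]exchange_big /=; apply: eq_bigr => i _; rewrite mulr_sumr.
  rewrite [RHS]exchange_big /=; apply: eq_bigr => j _; rewrite mulr_sumr.
  by rewrite [RHS]exchange_big /=; apply: eq_bigr => a _; exact: net_mono_rec.
apply: eq_bigr => s _.
rewrite sum_ffun3_eq_coord ?card_ord // => x i j a;
  have [upd_i upd_j upd_a] := net_mono_splice_upd A g h s t i j a;
  by rewrite ?(upd_i, upd_j, upd_a).
Qed.

End network.

Section weights.
Context {R : realType} {S : finType}.
Implicit Types (g h : {perm S}) (s t : S).

(* The power of [d] gained by splicing [s] out of [g] at [t]; see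
   [porbits_splice_weight]. *)
Definition orbit_weight (d : nat) g s t : R :=
  if s \in porbit g t then d%:R ^+ (s != t) else d%:R^-1.

Definition splice_weight (m n p k : nat) g h s t : R :=
  (m * n)%:R * p%:R ^+ (s == t) * orbit_weight m g s t * orbit_weight n h s t /
  (m * n * p + k.-1)%:R.

Lemma orbit_weight_neq0 d g s t : (0 < d)%N -> orbit_weight d g s t != 0.
Proof.
move=> d0; have nd : d%:R != 0 :> R by rewrite pnatr_eq0 -lt0n.
by rewrite /orbit_weight; case: ifP => _; rewrite ?invr_eq0 ?expf_neq0.
Qed.

Lemma porbits_splice_weight d g s t : (0 < d)%N ->
  d%:R ^+ #|porbits (splice s t g)| =
  d%:R ^+ #|porbits g| * orbit_weight d g s t * d%:R ^+ (g t != s) :> R.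
Proof.
move=> d0; have nd : d%:R != 0 :> R by rewrite pnatr_eq0 -lt0n.
have := card_porbits_splice s t g; rewrite /orbit_weight.
case: ifP => [_|sg] /= => [|e]; first by rewrite addn0 -!exprD => ->.
have st : s != t by apply: contraFneq sg => ->; exact: porbit_id.
apply: (mulIf (expf_neq0 2 nd)); rewrite -exprD e st !exprD expr1.
by rewrite -!mulrA; congr (_ * _); rewrite [RHS]mulrCA expr2 mulKf // mulrC.
Qed.

End weights.

Section normalized_network.
Context {R : realType} (m n p : nat).
Variable nu : probability (borelM R (m * n * p) 1) R.
Hypothesis nu_uniform : uniform_on_sphere nu.
Hypotheses (m_gt0 : (0 < m)%N) (n_gt0 : (0 < n)%N) (p_gt0 : (0 < p)%N).
Variable S : finType.
Implicit Types (A : {set S}) (g h : {perm S}) (s t : S).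

Definition normalized_net A g h : R := (m * n)%:R ^+ #|A| * net nu A g h /
  (m%:R ^+ #|porbits g| * n%:R ^+ #|porbits h| * p%:R ^+ (#|S| - #|A|)).

Lemma normalized_net_empty : normalized_net finset.set0 1%g 1%g = 1.
Proof.
have -> : normalized_net finset.set0 1%g 1%g = net nu finset.set0 1%g (1%g : {perm S}) /
    (m%:R ^+ #|S| * n%:R ^+ #|S| * p%:R ^+ #|S|).
  by rewrite /normalized_net cards0 expr0 mul1r subn0 card_porbits1.
rewrite (_ : net _ _ _ _ = m%:R ^+ #|S| * n%:R ^+ #|S| * p%:R ^+ #|S|).
  by rewrite divff // !mulf_neq0 ?expf_neq0 // pnatr_eq0 -lt0n.
transitivity (\sum_(i : {ffun S -> 'I_m}) \sum_(j : {ffun S -> 'I_n})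
    \sum_(a : {ffun S -> 'I_p}) (1 : R)).
  apply: eq_bigr => i _; apply: eq_bigr => j _; apply: eq_bigr => a _.
  rewrite -[RHS]/(rpart (1 : Cplx R)) -(expect_cst nu_uniform 1); congr rpart.
  by apply: eq_expect => x _; rewrite /net_mono /mono !big_set0 mulr1.
rewrite !sumr_const !card_ffun !card_ord -!mulrnA -!natrX -!natrM.
by congr (_%:R); ring.
Qed.

Lemma normalized_net_rec A g h t : t \in A ->
  normalized_net A g h = \sum_(s in A) splice_weight m n p #|A| g h s t *
    normalized_net (A :\ s) (splice s t g) (splice s t h).
Proof.
move=> tA; have [m0 n0 p0] : [/\ m%:R != 0 :> R, n%:R != 0 :> R & p%:R != 0 :> R].
  by rewrite !pnatr_eq0 -!lt0n.
set D : R := (m * n * p + #|A|.-1)%:R.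
have D0 : D != 0 by rewrite pnatr_eq0 -lt0n ltn_addr // !muln_gt0 m_gt0 n_gt0.
rewrite /normalized_net; have -> : net nu A g h = D^-1 * (D * net nu A g h) by rewrite mulKf.
have := net_rec nu_uniform m_gt0 n_gt0 p_gt0 g h tA; rewrite -/D => ->.
rewrite !mulr_sumr mulr_suml; apply: eq_bigr => s sA.
have cardA : #|A| = #|A :\ s|.+1 by rewrite (cardsD1 s A) sA.
have -> : (#|S| - #|A :\ s| = (#|S| - #|A|).+1)%N by rewrite cardA subnSK // -cardA max_card.
have -> : p%:R ^- (t != s) = p%:R ^+ (s == t) / p%:R :> R.
  by rewrite eq_sym; case: eqP => _; rewrite ?invr1 ?divff //= expr0 mul1r.
rewrite /splice_weight -/D !porbits_splice_weight // cardA (exprS _ #|A :\ s|) (exprS p%:R).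
have := expf_neq0 (g t != s) m0; have := expf_neq0 (h t != s) n0.
have := expf_neq0 #|porbits g| m0; have := expf_neq0 #|porbits h| n0.
have := expf_neq0 (#|S| - #|A|) p0; rewrite cardA.
have := @orbit_weight_neq0 R _ m g s t m_gt0; have := @orbit_weight_neq0 R _ n h s t n_gt0.
move: (_ ^+ #|porbits g|) (_ ^+ #|porbits h|) (_ ^+ (g t != s)) (_ ^+ (h t != s))
  (_ ^+ (#|S| - _)) (orbit_weight m g s t) (orbit_weight n h s t)
  (_ ^+ #|A :\ s|) (_ ^+ (s == t)) (net _ _ _ _).
move=> mg nh gs hs pS wg wh mnA pst L wh0 wg0 pS0 nh0 mg0 hs0 gs0.
clearbody D; by field; rewrite ?mg0 ?nh0 ?gs0 ?hs0 ?pS0 ?D0 ?p0 ?wg0 ?wh0.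
Qed.

End normalized_network.

Section network_limit.
Context {R : realType} {S : finType} (v : R) (p : nat -> nat).
Implicit Types (A : {set S}) (g h : {perm S}) (s t : S).
Hypothesis v_gt0 : 0 < v.
Hypothesis ratio_cvg : n%:R ^+ 2 / (p n)%:R @[n --> \oo] --> v.

Let inv_nat_cvg0 : (n%:R^-1 : R) @[n --> \oo] --> (0 : R).
Proof.
apply/gtr0_cvgV0; first by near=> n; rewrite ltr0n; near: n; exact: nbhs_infty_gt.
exact: cvgr_idn.
Unshelve. all: by end_near. Qed.

Lemma dims_gt0_near : \forall n \near \oo, (0 < n)%N && (0 < p n)%N.
Proof.
have : \forall n \near \oo, 0 < n%:R ^+ 2 / (p n)%:R :> R by exact: cvgr_gt ratio_cvg _ v_gt0.
apply: filterS => -[|n]; first by rewrite expr0n mul0r ltxx.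
by case: (p n.+1) => //; rewrite invr0 mulr0 ltxx.
Qed.

Let dims_neq0_near : \forall n \near \oo, n%:R != 0 :> R /\ (p n)%:R != 0 :> R.
Proof. by apply: filterS dims_gt0_near => n; rewrite !lt0n !pnatr_eq0 => /andP. Qed.

Let inv_p_cvg0 : (p n)%:R^-1 @[n --> \oo] --> (0 : R).
Proof.
rewrite -(mulr0 v) -(mulr0 (0 : R)).
apply: cvg_trans (cvgM ratio_cvg (cvgM inv_nat_cvg0 inv_nat_cvg0)).
apply: near_eq_cvg; apply: filterS dims_neq0_near => n [n0 _].
by rewrite /= mulrAC -expr2 -exprMn divff // expr1n mul1r.
Qed.

(* Every factor [v], [1 / p] or [1 / (n ^ 2 * p)] comes from whether [s] splits
   off a cycle of [g], of [h], of both or of neither. *)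
Lemma reduced_weight_cvg g h s t :
  (p n)%:R ^+ (s == t) * orbit_weight n g s t * orbit_weight n h s t / (p n)%:R
    @[n --> \oo] -->
  if s == t then 1 else if (s \in porbit g t) && (s \in porbit h t) then v else 0 : R.
Proof.
have eventually (w : nat -> R) (l : R) :
    (forall n, n%:R != 0 :> R -> (p n)%:R != 0 :> R ->
      (p n)%:R ^+ (s == t) * orbit_weight n g s t * orbit_weight n h s t / (p n)%:R = w n) ->
    w n @[n --> \oo] --> l ->
    (p n)%:R ^+ (s == t) * orbit_weight n g s t * orbit_weight n h s t / (p n)%:R
      @[n --> \oo] --> l.
  move=> wE; apply: cvg_trans; apply: near_eq_cvg.
  by apply: filterS dims_neq0_near => n [n0 p0]; rewrite wE.
case: (eqVneq s t) eventually => [->|st] eventually.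
  apply: (eventually (cst 1)); last exact: cvg_cst.
  by move=> n n0 p0; rewrite /orbit_weight !porbit_id eqxx expr1 expr0 !mulr1 divff.
have [sg|sg] /= := boolP (s \in porbit g t); have [sh|sh] := boolP (s \in porbit h t).
- apply: eventually ratio_cvg => n n0 p0.
  by rewrite /orbit_weight sg sh st expr0 expr1 mul1r.
- apply: eventually inv_p_cvg0 => n n0 p0.
  by rewrite /orbit_weight sg (negbTE sh) st expr0 expr1 mul1r divff ?mul1r.
- apply: eventually inv_p_cvg0 => n n0 p0.
  by rewrite /orbit_weight (negbTE sg) sh st expr0 expr1 mul1r mulVf ?mul1r.
apply: (eventually (fun n => n%:R^-1 * n%:R^-1 * (p n)%:R^-1)) => [n n0 p0|].
  by rewrite /orbit_weight (negbTE sg) (negbTE sh) expr0 mul1r.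
by rewrite -(mulr0 (0 * 0 : R)); do 2!apply: cvgM => //.
Qed.

Lemma splice_weight_cvg k g h s t :
  splice_weight n n (p n) k g h s t @[n --> \oo] -->
  if s == t then 1 else if (s \in porbit g t) && (s \in porbit h t) then v else 0 : R.
Proof.
pose c : R := k.-1%:R; pose u n : R := (1 + c * (n%:R^-1 * n%:R^-1 * (p n)%:R^-1))^-1.
have u_cvg : u n @[n --> \oo] --> (1 : R).
  rewrite -[X in _ --> X]invr1; apply: cvgV; first exact: oner_neq0.
  rewrite -[X in _ --> X]addr0; apply: cvgD; first exact: cvg_cst.
  rewrite -(mulr0 c) -(mulr0 (0 * 0 : R)); apply: cvgMl_tmp; do 2!apply: cvgM => //.
have splice_weightE : \forall n \near \oo, u n *
    ((p n)%:R ^+ (s == t) * orbit_weight n g s t * orbit_weight n h s t / (p n)%:R) =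
    splice_weight n n (p n) k g h s t.
  apply: filterS dims_neq0_near => n [n0 p0].
  rewrite /splice_weight /u natrD !natrM -/c.
  move: (_ ^+ (s == t)) (orbit_weight _ _ _ _) (orbit_weight _ _ _ _) => x y z.
  have -> : 1 + c * (n%:R^-1 * n%:R^-1 * (p n)%:R^-1) =
      (n%:R * n%:R * (p n)%:R + c) / (n%:R * n%:R * (p n)%:R) by field; rewrite n0 p0.
  by rewrite invf_div; set D := (_ + c)^-1; field; rewrite p0.
apply: cvg_trans (near_eq_cvg splice_weightE) _.
by rewrite -[if _ then _ else _]mul1r; exact: cvgM u_cvg (@reduced_weight_cvg g h s t).
Qed.

Variable L : nat -> {set S} -> {perm S} -> {perm S} -> R.
Hypothesis L_empty : \forall n \near \oo, L n finset.set0 1%g 1%g = 1.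
Hypothesis L_rec : \forall n \near \oo, forall A g h t, t \in A ->
  L n A g h = \sum_(s in A) splice_weight n n (p n) #|A| g h s t *
                L n (A :\ s) (splice s t g) (splice s t h).

Definition net_lim A g h : R := lim (L n A g h @[n --> \oo]).

Lemma net_empty_cvg : L n finset.set0 1%g 1%g @[n --> \oo] --> (1 : R).
Proof.
apply: cvg_trans (near_eq_cvg _) (@cvg_cst _ (1 : R) _ \oo _).
by apply: filterS L_empty => n ->.
Qed.

Lemma net_rec_cvg A g h t (l : S -> R) : t \in A ->
  (forall s, s \in A ->
     L n (A :\ s) (splice s t g) (splice s t h) @[n --> \oo] --> l s) ->
  L n A g h @[n --> \oo] --> \sum_(s in A) (if s == t then 1 else
    if (s \in porbit g t) && (s \in porbit h t) then v else 0) * l s.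
Proof.
move=> tA ls.
have rec : \forall n \near \oo, \sum_(s in A) splice_weight n n (p n) #|A| g h s t *
    L n (A :\ s) (splice s t g) (splice s t h) = L n A g h.
  by apply: filterS L_rec => n Ln; rewrite (Ln A g h t tA).
apply: cvg_trans (near_eq_cvg rec) _.
apply: cvg_big => [|s sA]; first exact: add_continuous.
by apply: cvgM; [exact: splice_weight_cvg|exact: ls].
Qed.

Lemma net_cvg A g h : perm_on A g -> perm_on A h ->
  L n A g h @[n --> \oo] --> net_lim A g h.
Proof.
have [k] := ubnP #|A|; elim: k A g h => // k IH A g h; rewrite ltnS => Ak gA hA.
suff : cvg (L n A g h @[n --> \oo]) by [].
have [A0|[t tA]] := set_0Vmem A; last first.
  pose l s := net_lim (A :\ s) (splice s t g) (splice s t h).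
  apply/cvg_ex; eexists; apply: (@net_rec_cvg A g h t l tA) => s sA.
  apply: IH; rewrite ?perm_on_splice // (leq_trans _ Ak) //.
  by rewrite [X in (_ < X)%N](cardsD1 s) sA.
have one (f : {perm S}) : perm_on A f -> f = 1%g.
  by move=> fA; apply/permP => x; rewrite perm1 (out_perm fA) // A0 inE.
by rewrite (one g gA) (one h hA) A0; apply/cvg_ex; exists 1; exact: net_empty_cvg.
Qed.

Lemma net_lim_empty : net_lim finset.set0 1%g 1%g = 1.
Proof. by apply: cvg_lim => //; exact: net_empty_cvg. Qed.

Lemma net_lim_rec A g h t : perm_on A g -> perm_on A h -> t \in A ->
  net_lim A g h = net_lim (A :\ t) (skip t g) (skip t h) +
    v * \sum_(s in A | [&& s != t, s \in porbit g t & s \in porbit h t])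
       net_lim (A :\ s) (splice s t g) (splice s t h).
Proof.
move=> gA hA tA; apply: cvg_lim => //.
have := @net_rec_cvg A g h t (fun s => net_lim (A :\ s) (splice s t g) (splice s t h)) tA.
move=> /(_ (fun s sA => net_cvg (perm_on_splice gA sA tA) (perm_on_splice hA sA tA))).
congr (_ --> _); rewrite (bigD1 t) //= eqxx mul1r !splice_head; congr (_ + _).
rewrite mulr_sumr big_mkcondr [RHS]big_mkcondr; apply: eq_bigr => s sA.
by case: eqP => //= _; case: ifP => _; rewrite ?mul0r.
Qed.

Lemma net_cycles_cvg qs g : has_cycles qs g ->
  L n (finset (fun x => x \in flatten qs)) g g^-1%g @[n --> \oo] -->
    \prod_(q <- qs) motzkin 1 v (size q) 0.
Proof.
move=> cyc; rewrite -(cycle_product net_lim_empty net_lim_rec cyc).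
by have [_ _ gA] := cyc; exact: net_cvg gA (perm_onV gA).
Qed.

End network_limit.

(** * Traces of powers as networks *)

Section sums_over_functions.
Variables (V : nmodType) (X : finType).

Definition ffun_cons k (x : X) (u : {ffun 'I_k -> X}) : {ffun 'I_k.+1 -> X} :=
  [ffun t => if unlift ord0 t is Some t' then u t' else x].

Lemma ffun_cons0 k x (u : {ffun 'I_k -> X}) : ffun_cons x u ord0 = x.
Proof. by rewrite ffunE unlift_none. Qed.

Lemma ffun_consS k x (u : {ffun 'I_k -> X}) t : ffun_cons x u (lift ord0 t) = u t.
Proof. by rewrite ffunE liftK. Qed.

Lemma sum_ffun_cons k (F : {ffun 'I_k.+1 -> X} -> V) :
  \sum_(u : {ffun 'I_k.+1 -> X}) F u = \sum_x \sum_(u : {ffun 'I_k -> X}) F (ffun_cons x u).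
Proof.
rewrite pair_bigA /= (reindex (fun xu : X * {ffun 'I_k -> X} => ffun_cons xu.1 xu.2)) //.
exists (fun u : {ffun 'I_k.+1 -> X} => (u ord0, [ffun t => u (lift ord0 t)])).
  move=> [x u] _ /=; rewrite ffun_cons0; congr pair.
  by apply/ffunP => t; rewrite ffunE ffun_consS.
move=> u _; apply/ffunP => t; case: (unliftP ord0 t) => [t' ->|->].
  by rewrite ffun_consS ffunE.
by rewrite ffun_cons0.
Qed.

Definition ffun_copair (S1 S2 : finType) (u1 : {ffun S1 -> X}) (u2 : {ffun S2 -> X}) :
    {ffun S1 + S2 -> X} :=
  [ffun t => match t with inl t1 => u1 t1 | inr t2 => u2 t2 end].

Lemma sum_ffun_copair (S1 S2 : finType) (F : {ffun S1 + S2 -> X} -> V) :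
  \sum_(u : {ffun S1 + S2 -> X}) F u =
  \sum_(u1 : {ffun S1 -> X}) \sum_(u2 : {ffun S2 -> X}) F (ffun_copair u1 u2).
Proof.
rewrite pair_bigA /=
  (reindex (fun uu : {ffun S1 -> X} * {ffun S2 -> X} => ffun_copair uu.1 uu.2)) //.
exists (fun u : {ffun S1 + S2 -> X} => ([ffun t => u (inl t)], [ffun t => u (inr t)])).
  by move=> [u1 u2] _ /=; congr pair; apply/ffunP => t; rewrite !ffunE.
by move=> u _; apply/ffunP => -[t|t]; rewrite !ffunE.
Qed.

End sums_over_functions.

Section trace_power.
Variables (K : comPzRingType) (n : nat) (B : 'M[K]_n).

Definition walk k (a : 'I_n) (u : {ffun 'I_k -> 'I_n}) (b : 'I_n) : K :=
  \prod_(t < k.+1) B (ffun_cons a u t) (if unlift ord_max t is Some t' then u t' else b).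

Lemma mx_pow_walk k a b : (B ^+ k.+1) a b = \sum_(u : {ffun 'I_k -> 'I_n}) walk a u b.
Proof.
elim: k a b => [|k IH] a b.
  rewrite expr1 (big_pred1 [ffun t : 'I_0 => a]) /walk => [|u]; last first.
    by apply/esym/eqP/ffunP => -[].
  by rewrite big_ord1 ffun_cons0 (_ : ord0 = ord_max) ?unlift_none //; exact: val_inj.
rewrite exprS mxE sum_ffun_cons; apply: eq_bigr => c _.
rewrite IH mulr_sumr; apply: eq_bigr => u _; rewrite /walk [RHS]big_ord_recl.
congr (_ * _).
  rewrite ffun_cons0 (_ : ord0 = lift ord_max ord0) ?liftK ?ffun_cons0 //; exact: val_inj.
apply: eq_bigr => t _; rewrite ffun_consS; congr (B _ _).
case: (unliftP ord_max t) => [t' ->|->].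
  rewrite (_ : lift ord0 (lift ord_max t') = lift ord_max (lift ord0 t')).
    by rewrite liftK ffun_consS.
  have tk : (k <= t')%N = false by rewrite leqNgt ltn_ord.
  by apply: val_inj; rewrite /= /bump /= !add1n ltnS tk.
by rewrite (_ : lift ord0 ord_max = ord_max) ?unlift_none //; exact: val_inj.
Qed.

Definition cyclic_sum k : K :=
  \sum_(u : {ffun 'I_k -> 'I_n}) \prod_(t < k) B (u t) (u (ordS t)).

Lemma cyclic_sum0 : cyclic_sum 0 = 1.
Proof.
rewrite /cyclic_sum; under eq_bigr do rewrite big_ord0.
by rewrite sumr_const card_ffun !card_ord.
Qed.

Lemma mxtrace_exp k : \tr (B ^+ k.+1) = cyclic_sum k.+1.
Proof.
rewrite /cyclic_sum sum_ffun_cons; apply: eq_bigr => a _; rewrite mx_pow_walk.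
apply: eq_bigr => u _; apply: eq_bigr => t _; congr (B _ _).
case: (unliftP ord_max t) => [t' ->|->].
  rewrite (_ : ordS (lift ord_max t') = lift ord0 t') ?ffun_consS //.
  apply: val_inj; rewrite /= /bump leqNgt ltn_ord add0n modn_small ?add1n //.
  by rewrite ltnS ltn_ord.
rewrite (_ : ordS ord_max = ord0) ?ffun_cons0 //.
by apply: val_inj; rewrite /= modnn.
Qed.

End trace_power.

Section double_rotation.
Variables k l : nat.

Definition rotate_sum (t : 'I_k + 'I_l) : 'I_k + 'I_l :=
  match t with inl s => inl (ordS s) | inr s => inr (ordS s) end.

Lemma rotate_sum_inj : injective rotate_sum.
Proof.
pose back (t : 'I_k + 'I_l) : 'I_k + 'I_l :=
  match t with inl s => inl (ord_pred s) | inr s => inr (ord_pred s) end.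
by apply: (@can_inj _ _ _ back) => -[s|s] /=; rewrite ordSK.
Qed.

Definition double_rotation : {perm 'I_k + 'I_l} := perm rotate_sum_inj.

Definition rotation_cycles : seq (seq ('I_k + 'I_l)) :=
  [:: map inl (enum 'I_k); map inr (enum 'I_l)].

Lemma fcycle_ordS m : fcycle (@ordS m) (enum 'I_m).
Proof.
case: m => [|m]; first by rewrite (size0nil (size_enum_ord 0)).
apply: cycle_from_next; first exact: enum_uniq.
move=> x _; rewrite next_nth mem_enum /=; apply/eqP/val_inj => /=.
case E: (enum _) => [|y q]; first by have := mem_enum 'I_m.+1 x; rewrite E.
rewrite -[nth y q _]/(nth y (y :: q) (index x (y :: q)).+1) -E index_enum_ord.
have y0 : y = 0%N :> nat by have := @nth_enum_ord m.+1 x 0 isT; rewrite E.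
have [xm|mx] := ltnP x.+1 m.+1; first by rewrite nth_enum_ord // modn_small.
have -> : x.+1 = m.+1 by apply/eqP; rewrite eqn_leq ltn_ord.
by rewrite nth_default ?size_enum_ord // modnn y0.
Qed.

Lemma rotation_cycles_full : [set x in flatten rotation_cycles]%SET = [set: 'I_k + 'I_l]%SET.
Proof.
apply/setP => t; rewrite !inE /= cats0 mem_cat; case: t => s.
  by rewrite map_f ?mem_enum.
by rewrite [X in _ || X]map_f ?mem_enum // orbT.
Qed.

Lemma has_cycles_double_rotation : has_cycles rotation_cycles double_rotation.
Proof.
split.
- rewrite /= cats0 cat_uniq map_inj_uniq; last by move=> ? ? [].
  rewrite [X in [&& _, _ & X]]map_inj_uniq; last by move=> ? ? [].
  rewrite !enum_uniq andbT /=.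
  by apply/hasPn => _ /mapP[s _ ->]; apply/mapP => -[].
- rewrite /= andbT; apply/andP; split; rewrite cycle_map.
    rewrite (@eq_cycle _ _ (frel (@ordS k))) ?fcycle_ordS // => s t /=.
    by rewrite permE.
  rewrite (@eq_cycle _ _ (frel (@ordS l))) ?fcycle_ordS // => s t /=.
  by rewrite permE.
by rewrite rotation_cycles_full; apply/fintype.subsetP => x; rewrite inE.
Qed.

Lemma card_porbits_double_rotation : #|porbits double_rotation| = ((0 < k) + (0 < l))%N.
Proof.
rewrite (card_porbits_cycles has_cycles_double_rotation rotation_cycles_full) /= addn0.
by rewrite -2!size_eq0 size_map size_enum_ord size_map size_enum_ord -2!lt0n.
Qed.

Lemma mul_cyclic_sum (K : comPzRingType) n (B : 'M[K]_n) :
  cyclic_sum B k * cyclic_sum B l =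
  \sum_(u : {ffun 'I_k + 'I_l -> 'I_n}) \prod_t B (u t) (u (double_rotation t)).
Proof.
rewrite sum_ffun_copair /cyclic_sum mulr_suml; apply: eq_bigr => u1 _.
rewrite mulr_sumr; apply: eq_bigr => u2 _; rewrite big_sumType /=.
by congr (_ * _); apply: eq_bigr => t _; rewrite permE !ffunE.
Qed.

End double_rotation.

Lemma sum_ffun_mxtens (V : nmodType) (S : finType) m n (F : {ffun S -> 'I_(m * n)} -> V) :
  \sum_(u : {ffun S -> 'I_(m * n)}) F u =
  \sum_(i : {ffun S -> 'I_m}) \sum_(j : {ffun S -> 'I_n})
    F [ffun t => mxtens_index (i t, j t)].
Proof.
rewrite pair_bigA /= (reindex (fun ij : {ffun S -> 'I_m} * {ffun S -> 'I_n} =>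
  [ffun t => mxtens_index (ij.1 t, ij.2 t)] : {ffun S -> 'I_(m * n)})) //.
exists (fun u : {ffun S -> 'I_(m * n)} =>
  ([ffun t => (mxtens_unindex (u t)).1], [ffun t => (mxtens_unindex (u t)).2])).
  by move=> [i j] _; congr pair; apply/ffunP => t; rewrite !ffunE mxtens_indexK.
move=> u _; apply/ffunP => t; rewrite !ffunE -[RHS]mxtens_unindexK.
by case: (mxtens_unindex (u t)).
Qed.

Lemma sum_ffun_perm (V : nmodType) (S X : finType) (g : {perm S}) (F : {ffun S -> X} -> V) :
  \sum_(u : {ffun S -> X}) F u = \sum_(u : {ffun S -> X}) F [ffun t => u (g t)].
Proof.
rewrite (reindex_inj (h := fun u : {ffun S -> X} => [ffun t => u (g t)])) //.
by move=> u u' /ffunP uu'; apply/ffunP => t; have := uu' (g^-1%g t); rewrite !ffunE permKV.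
Qed.

Section traces.
Context {R : realType} (m n p : nat).
Local Notation C := (Cplx R).
Implicit Types x : 'cV[C]_(m * n * p).

Definition pt_state x : 'M[C]_(m * n) := (m * n)%:R *: ptranspose (reduced_state x).

Lemma pt_stateE x i j i' j' :
  pt_state x (mxtens_index (i, j)) (mxtens_index (i', j')) =
  (m * n)%:R * \sum_(a < p) x (cell i j' a) 0 * (x (cell i' j a) 0)^*.
Proof.
rewrite 3!mxE !mxtens_indexK /=; congr (_ * _); apply: eq_bigr => a _.
by rewrite mxE big_ord1 !mxE.
Qed.

(* The partial transposition swaps the second indices of the two factors, so
   that they run along the inverse permutation. *)
Lemma mul_cyclic_sum_pt k l x : let g := double_rotation k l in
  cyclic_sum (pt_state x) k * cyclic_sum (pt_state x) l =
  (m * n)%:R ^+ (k + l) * \sum_(i : {ffun 'I_k + 'I_l -> 'I_m})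
    \sum_(j : {ffun 'I_k + 'I_l -> 'I_n}) \sum_(a : {ffun 'I_k + 'I_l -> 'I_p})
    net_mono (finset.setTfor ('I_k + 'I_l)) g g^-1%g i j a x.
Proof.
move=> g; rewrite mul_cyclic_sum sum_ffun_mxtens mulr_sumr; apply: eq_bigr => i _.
rewrite (sum_ffun_perm g^-1%g) mulr_sumr; apply: eq_bigr => j _.
transitivity (\prod_(t : 'I_k + 'I_l) ((m * n)%:R * \sum_(a < p)
    x (cell (i t) (j t) a) 0 * (x (cell (i (g t)) (j (g^-1%g t)) a) 0)^*)).
  by apply: eq_bigr => t _; rewrite !ffunE pt_stateE permK.
rewrite big_split /= prodr_const card_sum !card_ord bigA_distr_bigA /=.
congr (_ * _); apply: eq_bigr => a _; rewrite big_split /= /net_mono /mono.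
by congr (_ * _); apply: eq_bigl => t; rewrite inE.
Qed.

Lemma bounded_pt_state r c : bounded_continuous (fun x => pt_state x r c).
Proof.
rewrite -[r]mxtens_unindexK -[c]mxtens_unindexK.
case: (mxtens_unindex r) => i j; case: (mxtens_unindex c) => i' j'.
under eq_fun do rewrite pt_stateE.
apply: bounded_continuousZ; apply: bounded_continuous_sum => a _.
apply: bounded_continuousM; first exact: bounded_continuous_coord.
by apply: bounded_continuous_conj; exact: bounded_continuous_coord.
Qed.

Definition ntrace k x : C := (m * n)%:R^-1 * \tr (pt_state x ^+ k).

Lemma bounded_ntrace k : bounded_continuous (ntrace k).
Proof.
apply: bounded_continuousZ; apply: bounded_continuous_sum => r _; move: {2}r => c.
elim: k r c => [|k IH] r c.
  by under eq_fun do rewrite expr0; exact: bounded_continuous_cst.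
under eq_fun do rewrite exprS mxE; apply: bounded_continuous_sum => j _.
by apply: bounded_continuousM; [exact: bounded_pt_state|exact: IH].
Qed.

Hypotheses (m_gt0 : (0 < m)%N) (n_gt0 : (0 < n)%N).

Lemma ntraceE k x : ntrace k x = (m * n)%:R ^- (0 < k)%N * cyclic_sum (pt_state x) k.
Proof.
case: k => [|k]; last by rewrite /ntrace mxtrace_exp.
rewrite /ntrace cyclic_sum0 expr0 mxtrace1 mulVf ?invr1 ?mul1r //.
by rewrite pnatr_eq0 -lt0n muln_gt0 m_gt0.
Qed.

Variable nu : probability (borelM R (m * n * p) 1) R.
Hypothesis nu_uniform : uniform_on_sphere nu.

Lemma expect_mul_ntrace k l :
  let g := double_rotation k l in let T := finset.setTfor ('I_k + 'I_l) in
  expect nu (fun x => ntrace k x * ntrace l x) =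
  creal ((m * n)%:R ^+ (k + l) / (m * n)%:R ^+ #|porbits g|) *
    \sum_i \sum_j \sum_a expect nu (net_mono T g g^-1%g i j a).
Proof.
move=> g T; set c := creal _.
have bm i j a : bounded_continuous (@net_mono R m n p _ T g g^-1%g i j a).
  exact: mono_bounded.
pose X := {ffun 'I_k + 'I_l -> 'I_m}; pose Y := {ffun 'I_k + 'I_l -> 'I_n}.
pose Z := {ffun 'I_k + 'I_l -> 'I_p}.
transitivity (expect nu (fun x => c * (\sum_(i : X) \sum_(j : Y) \sum_(a : Z)
    net_mono T g g^-1%g i j a x))).
  apply: eq_expect => x _; rewrite !ntraceE mulrACA mul_cyclic_sum_pt mulrA.
  congr (_ * _); rewrite /c fmorph_div !rmorphXn /= !rmorph_nat.
  by rewrite -invfM -exprD mulrC card_porbits_double_rotation.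
rewrite expectZ; last first.
  by do 2![apply: bounded_continuous_sum => ? _]; apply: bounded_continuous_sum.
congr (_ * _); rewrite expect_sum => [|i _]; last first.
  by apply: bounded_continuous_sum => ? _; apply: bounded_continuous_sum.
apply: eq_bigr => i _; rewrite expect_sum => [|j _]; last exact: bounded_continuous_sum.
by apply: eq_bigr => j _; rewrite expect_sum.
Qed.

Lemma rpart_expect_mul_ntrace k l :
  rpart (expect nu (fun x => ntrace k x * ntrace l x)) =
  normalized_net nu (finset.setTfor ('I_k + 'I_l)) (double_rotation k l)
    (double_rotation k l)^-1%g.
Proof.
rewrite expect_mul_ntrace /normalized_net cardsT card_sum !card_ord subnn expr0 mulr1.
rewrite porbitsV -exprMn -natrM mulrAC.
rewrite rpart_crealM; congr (_ * _); rewrite raddf_sum; apply: eq_bigr => i _ /=.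
by rewrite raddf_sum; apply: eq_bigr => j _ /=; rewrite raddf_sum.
Qed.

End traces.

(** * Moments of the semicircle law *)

Section chebyshev.
Variables (K : comNzRingType) (m v : K).

(* The orthogonal polynomials of SC(m, v): rescaled Chebyshev polynomials of the
   second kind. *)
Fixpoint cheb n : {poly K} :=
  match n with
  | 0 => 1
  | n'.+1 => ('X - m%:P) * cheb n' - (if n' is n''.+1 then v *: cheb n'' else 0)
  end.

Lemma cheb0 : cheb 0 = 1. Proof. by []. Qed.

Lemma cheb1 : cheb 1 = 'X - m%:P. Proof. by rewrite /= mulr1 subr0. Qed.

Lemma chebSS n : cheb n.+2 = ('X - m%:P) * cheb n.+1 - v *: cheb n.
Proof. by []. Qed.

Lemma orthogonal_cheb_motzkin (phi : {scalar {poly K}}) :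
  (forall n, phi (cheb n) = (n == 0)%:R) ->
  forall k n, phi ('X^k * cheb n) = v ^+ n * motzkin m v k n.
Proof.
move=> phi_cheb; elim=> [|k IH] n.
  by rewrite mul1r phi_cheb; case: n => [|n]; rewrite ?mulr0 ?mulr1.
have phi_comb a b p q r : phi ('X^k * (p + a *: q + b *: r)) =
    phi ('X^k * p) + a * phi ('X^k * q) + b * phi ('X^k * r).
  by rewrite !mulrDr -!scalerAr !linearD !linearZ.
rewrite exprSr -mulrA; case: n => [|n].
  have -> : 'X * cheb 0 = cheb 1 + m *: cheb 0 + 0 *: 0.
    by rewrite cheb1 cheb0 mulr1 alg_polyC subrK scale0r addr0.
  by rewrite phi_comb !IH motzkinS0; ring.
have -> : 'X * cheb n.+1 = cheb n.+2 + m *: cheb n.+1 + v *: cheb n.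
  by rewrite chebSS mulrBl mul_polyC addrAC subrK subrK.
by rewrite phi_comb !IH motzkinSS !exprS; ring.
Qed.

Lemma moment_motzkin (phi : {scalar {poly K}}) :
  (forall n, phi (cheb n) = (n == 0)%:R) -> forall k, phi 'X^k = motzkin m v k 0.
Proof.
by move=> phi_cheb k; have := orthogonal_cheb_motzkin phi_cheb k 0; rewrite mulr1 mul1r.
Qed.

End chebyshev.
Arguments cheb : simpl never.

Section real_integrals.
Context {R : realType}.
Local Notation mu := (@lebesgue_measure R).
Implicit Types (a b : R) (f F G : R -> R).

Lemma continuous_integrable_itv a b f : continuous f ->
  mu.-integrable `[a, b] (EFin \o f).
Proof.
move=> cf; apply: continuous_compact_integrable; first exact: segment_compact.
exact: continuous_subspaceT.
Qed.

Lemma Rintegral_derive a b f F : a < b -> continuous f ->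
  (forall x : R, is_derive x 1 F (f x)) -> \int[mu]_(x in `[a, b]) f x = F b - F a.
Proof.
move=> ab cf dF; have F_derivable (x : R) : derivable F x 1 by exact: ex_derive.
have cF : continuous F by move=> x; exact/differentiable_continuous/derivable1_diffP.
rewrite /Rintegral (@continuous_FTC2 _ f F a b ab) //.
- exact: continuous_subspaceT.
- by split=> //; [apply: cvg_at_right_filter|apply: cvg_at_left_filter]; exact: cF.
- by move=> x _; rewrite derive1E; exact: derive_val.
Qed.

Lemma Rintegral_substitution_decreasing a b f F G : a < b ->
  {in `[a, b] &, {homo F : x y /~ x < y}} -> (forall x : R, is_derive x 1 F (f x)) ->
  continuous f -> continuous G ->
  \int[mu]_(x in `[F b, F a]) G x = \int[mu]_(x in `[a, b]) (G (F x) * - f x).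
Proof.
move=> ab decrF dF cf cG; have F_derivable (x : R) : derivable F x 1 by exact: ex_derive.
have cF : continuous F by move=> x; exact/differentiable_continuous/derivable1_diffP.
have F'E : derive1 F = f by apply/funext => x; rewrite derive1E; exact: derive_val.
rewrite /Rintegral integration_by_substitution_decreasing ?F'E //; first exact: ltW.
- by apply: (cvgP (f a)); apply: cvg_at_right_filter; exact: cf.
- by apply: (cvgP (f b)); apply: cvg_at_left_filter; exact: cf.
- by split=> //; [apply: cvg_at_right_filter|apply: cvg_at_left_filter]; exact: cF.
exact: continuous_subspaceT.
Qed.

Lemma sin_natpi k : sin (k%:R * pi) = 0 :> R.
Proof.
elim: k => [|k IH]; first by rewrite mul0r sin0.
by rewrite -natr1 mulrDl mul1r sinDpi IH oppr0.
Qed.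

Lemma continuous_cosMl c : continuous (fun x : R => cos (c * x)).
Proof.
move=> x; apply: continuous_comp; last exact: continuous_cos.
by apply: cvgMl_tmp; exact: cvg_id.
Qed.

Lemma integral_cos_nat k :
  \int[mu]_(x in `[0, pi]) cos (k%:R * x) = (k == 0)%:R * pi.
Proof.
case: k => [|k].
  rewrite mul1r; transitivity (\int[mu]_(x in `[0, (pi : R)]) cst 1 x).
    by apply: eq_Rintegral => x _; rewrite mul0r cos0.
  have mu_pi : mu `[0, pi]%classic = pi%:E.
    by rewrite lebesgue_measure_itv /= lte_fin pi_gt0 oppr0 adde0.
  by rewrite Rintegral_cst // [X in fine X]mu_pi mul1r.
have k0 : k.+1%:R != 0 :> R by rewrite pnatr_eq0.
have dF (x : R) : is_derive x 1 (fun y => k.+1%:R^-1 * sin (k.+1%:R * y)) (cos (k.+1%:R * x)).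
  have dk : is_derive x 1 ( *%R k.+1%:R) (k.+1%:R : R).
    by apply: is_derive_eq; rewrite /GRing.scale /= mulr1.
  have dsin := is_derive1_comp (is_derive_sin (k.+1%:R * x)) dk.
  have -> : cos (k.+1%:R * x) = k.+1%:R^-1 * (cos (k.+1%:R * x) * k.+1%:R).
    by rewrite mulrCA mulVf ?mulr1.
  exact: is_deriveZ.
rewrite (Rintegral_derive (pi_gt0 R) (@continuous_cosMl k.+1%:R) dF).
by rewrite sin_natpi !mulr0 sin0 mulr0 subrr mul0r.
Qed.

Lemma integral_sin_sin n :
  \int[mu]_(x in `[0, pi]) (sin (n.+1%:R * x) * sin x) = (n == 0)%:R * (pi / 2).
Proof.
have icos k : mu.-integrable `[0, pi] (EFin \o (fun x : R => cos (k%:R * x))).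
  exact/continuous_integrable_itv/continuous_cosMl.
transitivity (\int[mu]_(x in `[0, pi]) (2^-1 * (cos (n%:R * x) - cos (n.+2%:R * x)))).
  apply: eq_Rintegral => x _; have -> : n%:R * x = n.+1%:R * x - x by rewrite -natr1; ring.
  have -> : n.+2%:R * x = n.+1%:R * x + x by rewrite -(natr1 n.+1); ring.
  by rewrite cosB cosD; field.
rewrite RintegralZl //; last first.
  by apply: continuous_integrable_itv => x; apply: cvgB; exact: continuous_cosMl.
rewrite RintegralB // !integral_cos_nat mul0r subr0.
by case: n => [|n]; rewrite ?mul0r ?mulr0 // !mul1r mulrC.
Qed.

End real_integrals.

Section semicircle_moments.
Context {R : realType}.
Variables (m v : R).
Hypothesis v_gt0 : 0 < v.
Local Notation mu := (@lebesgue_measure R).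
Local Notation s := (Num.sqrt v).
Local Notation support := (`[m - 2 * s, m + 2 * s]%classic : set R).
Local Notation pdf := (semicircle_pdf m v).

Let s_gt0 : 0 < s. Proof. by rewrite sqrtr_gt0. Qed.

Let sqr_s : s ^+ 2 = v. Proof. by rewrite sqr_sqrtr // ltW. Qed.

Lemma semicircle_pdf_continuous : continuous pdf.
Proof.
rewrite (_ : pdf = fun x => (2 * pi * v)^-1 * Num.sqrt ((4 * v)%:P - ('X - m%:P) ^+ 2).[x]).
  move=> x; apply: cvgMl_tmp; apply: continuous_comp; last exact: sqrt_continuous.
  exact: continuous_horner.
by apply/funext => x; rewrite !hornerE.
Qed.

Lemma semicircle_pdf_ge0 x : 0 <= pdf x.
Proof.
by rewrite mulr_ge0 ?sqrtr_ge0 // invr_ge0 !mulr_ge0 ?pi_ge0 // ltW.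
Qed.

Lemma semicircle_pdf_le x : pdf x <= (pi * s)^-1.
Proof.
rewrite (_ : (pi * s)^-1 = (2 * pi * v)^-1 * Num.sqrt (4 * v)); last first.
  rewrite (_ : 4 = 2 ^+ 2 :> R) -?natrX // sqrtrM ?sqr_ge0 // natrX sqrtr_sqr ger0_norm //.
  rewrite -[X in 2 * pi * X]sqr_s.
  by move: pi (pi_gt0 R) => q q_gt0; field; rewrite !gt_eqF.
apply: ler_wpM2l; first by rewrite invr_ge0 !mulr_ge0 ?pi_ge0 ?ltW.
by rewrite ler_wsqrtr // lerBlDr lerDl sqr_ge0.
Qed.

Lemma cheb_cos n t : (cheb m v n).[m + 2 * s * cos t] * sin t = s ^+ n * sin (n.+1%:R * t).
Proof.
have [k] := ubnP n; elim: k n => // k IH [|[|n]] nk.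
- by rewrite cheb0 hornerC expr0 !mul1r.
- have -> : 2%:R * t = t + t by rewrite mulr_natl.
  by rewrite cheb1 !hornerE sinD; ring.
transitivity (2 * s * cos t * ((cheb m v n.+1).[m + 2 * s * cos t] * sin t) -
    v * ((cheb m v n).[m + 2 * s * cos t] * sin t)).
  by rewrite chebSS hornerD hornerN hornerZ hornerM hornerXsubC; ring.
rewrite (IH n.+1 nk) (IH n (ltnW nk)).
have -> : n.+3%:R * t = n.+2%:R * t + t by rewrite -(natr1 n.+2); ring.
have -> : n.+1%:R * t = n.+2%:R * t - t by rewrite -(natr1 n.+1); ring.
by rewrite sinB sinD -[X in _ - X * (_ * (_ - _))]sqr_s !exprS; ring.
Qed.

Definition semicircle_mean (f : R -> R) : R := \int[mu]_(x in support) (f x * pdf x).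

Definition semicircle_moment (p : {poly R}) : R := semicircle_mean (horner p).

Lemma continuous_horner_pdf (p : {poly R}) : continuous (fun x => p.[x] * pdf x).
Proof.
by move=> x; apply: cvgM; [exact: continuous_horner|exact: semicircle_pdf_continuous].
Qed.

Lemma integrable_horner_pdf (p : {poly R}) :
  mu.-integrable support (EFin \o (fun x => p.[x] * pdf x)).
Proof. by apply: continuous_integrable_itv; exact: continuous_horner_pdf. Qed.

Fact semicircle_moment_is_scalar : scalar semicircle_moment.
Proof.
move=> a p q; rewrite /semicircle_moment /semicircle_mean -RintegralZl ?integrable_horner_pdf //.
rewrite -RintegralD ?integrable_horner_pdf //.
  by apply: eq_Rintegral => x _; rewrite hornerD hornerZ; ring.
rewrite (_ : (fun x => a * _) = (fun x => (a *: p).[x] * pdf x)).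
  exact: integrable_horner_pdf.
by apply/funext => x; rewrite hornerZ mulrA.
Qed.

HB.instance Definition _ :=
  GRing.isLinear.Build R {poly R} R *%R semicircle_moment semicircle_moment_is_scalar.

Lemma semicircle_pdf_cos t : 0 <= t <= pi -> pdf (m + 2 * s * cos t) = (pi * s)^-1 * sin t.
Proof.
move=> /andP[t0 tpi]; have sin_ge0 : 0 <= sin t by rewrite sin_ge0_pi // t0.
rewrite /semicircle_pdf (_ : 4 * v - _ = (2 * s * sin t) ^+ 2); last first.
  by rewrite exprMn sin2cos2 -[X in 4 * X]sqr_s; ring.
rewrite sqrtr_sqr ger0_norm; last by rewrite !mulr_ge0 // ltW.
rewrite -[X in 2 * pi * X]sqr_s.
by move: pi (pi_gt0 R) => q q_gt0; field; rewrite !gt_eqF.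
Qed.

Lemma semicircle_momentE (p : {poly R}) : semicircle_moment p =
  2 / pi * \int[mu]_(t in `[0, pi]) (p.[m + 2 * s * cos t] * sin t * sin t).
Proof.
pose F t := m + 2 * s * cos t.
have dF (t : R) : is_derive t 1 F (- (2 * s * sin t)).
  rewrite -[X in is_derive _ _ _ X]add0r -mulrN.
  by apply: is_deriveD; apply: is_deriveZ.
have cf : continuous (fun t : R => - (2 * s * sin t)).
  by move=> t; apply: cvgN; apply: cvgMl_tmp; exact: continuous_sin.
have cF : continuous F.
  by move=> t; apply: cvgD; [exact: cvg_cst|apply: cvgMl_tmp; exact: continuous_cos].
have decrF : {in `[0, pi] &, {homo F : x y /~ x < y}}.
  by move=> x y x0 y0 xy; rewrite ltrD2l ltr_pM2l ?mulr_gt0 // ltr_cos.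
rewrite /semicircle_moment /semicircle_mean (_ : support = `[F pi, F 0]%classic); last first.
  by rewrite /F cos0 cospi mulrN1 mulr1.
rewrite (Rintegral_substitution_decreasing (pi_gt0 R) decrF dF cf (@continuous_horner_pdf p)).
rewrite -RintegralZl //; last first.
  apply: continuous_integrable_itv => t; apply: cvgM; last exact: continuous_sin.
  apply: cvgM; last exact: continuous_sin.
  by apply: (@continuous_comp _ _ _ F (horner p)); [exact: cF|exact: continuous_horner].
apply: eq_Rintegral => t; rewrite inE /= in_itv /= => t_pi.
rewrite semicircle_pdf_cos // /F.
by move: pi (pi_gt0 R) => q q_gt0; field; rewrite !gt_eqF.
Qed.

Lemma semicircle_moment_cheb n : semicircle_moment (cheb m v n) = (n == 0)%:R.
Proof.
rewrite semicircle_momentE.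
under eq_Rintegral do rewrite cheb_cos -mulrA.
rewrite RintegralZl ?integral_sin_sin //; last first.
  apply: continuous_integrable_itv => t; apply: cvgM; last exact: continuous_sin.
  by apply: continuous_comp; [apply: cvgMl_tmp; exact: cvg_id|exact: continuous_sin].
case: n => [|n]; rewrite ?mul0r ?mulr0 //= expr0 !mul1r.
by rewrite mulrA divfK ?divff // gt_eqF ?pi_gt0.
Qed.

Lemma semicircle_momentX k : semicircle_moment 'X^k = motzkin m v k 0.
Proof. exact/moment_motzkin/semicircle_moment_cheb. Qed.

Lemma semicircle_moment1 : semicircle_moment 1 = 1.
Proof. exact: (semicircle_moment_cheb 0). Qed.

Lemma semicircle_momentC c : semicircle_moment c%:P = c.
Proof. by rewrite -alg_polyC linearZ /= semicircle_moment1 mulr1. Qed.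

End semicircle_moments.

(** * Polynomial majorants and minorants of intervals *)

Section poly_approximable.
Context {R : realType}.
Implicit Types (a b c del x : R) (f g : R -> R).

Definition poly_approximable f := forall B e : R, 0 < e ->
  exists p : {poly R}, forall x, `|x| <= B -> `|p.[x] - f x| <= e.

Lemma poly_approximableD f g : poly_approximable f -> poly_approximable g ->
  poly_approximable (f \+ g).
Proof.
move=> approx_f approx_g B e e_gt0; have e2_gt0 : 0 < e / 2 by rewrite divr_gt0.
have [p pf] := approx_f B _ e2_gt0; have [q qg] := approx_g B _ e2_gt0.
exists (p + q) => x xB; rewrite hornerD opprD addrACA [leRHS]splitr.
by rewrite (le_trans (ler_normD _ _)) // lerD ?pf ?qg.
Qed.

Lemma poly_approximableZ c f : poly_approximable f -> poly_approximable (fun x => c * f x).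
Proof.
move=> approx_f B e e_gt0; have c1_gt0 : 0 < `|c| + 1 by rewrite ltr_wpDl.
have [p pf] := approx_f B _ (divr_gt0 e_gt0 c1_gt0).
exists (c *: p) => x xB; rewrite hornerZ -mulrBr normrM.
apply: le_trans (ler_wpM2l (normr_ge0 c) (pf x xB)) _.
by rewrite mulrCA ler_piMr ?ltW // ltr_pdivrMr // mul1r ltrDl.
Qed.

Lemma poly_approximableN f : poly_approximable f -> poly_approximable (\- f).
Proof.
move=> approx_f B e e_gt0; have [p pf] := approx_f B e e_gt0.
by exists (- p) => x xB; rewrite hornerN -opprD normrN pf.
Qed.

Lemma poly_approximableB f g : poly_approximable f -> poly_approximable g ->
  poly_approximable (f \- g).
Proof. by move=> approx_f approx_g; exact/poly_approximableD/poly_approximableN. Qed.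

Lemma poly_approximable_shift c f : poly_approximable f -> poly_approximable (fun x => f (x - c)).
Proof.
move=> approx_f B e e_gt0; have [p pf] := approx_f (B + `|c|) e e_gt0.
exists (p \Po ('X - c%:P)) => x xB; rewrite horner_comp !hornerE; apply: pf.
by rewrite (le_trans (ler_normB _ _)) // lerD2r.
Qed.

(* Visser's iteration for the square root of x^2. *)
Fixpoint abs_poly n : {poly R} :=
  if n is n'.+1 then abs_poly n' + 2^-1 *: ('X^2 - abs_poly n' ^+ 2) else 0.

Lemma abs_poly_bounds n x : `|x| <= 1 ->
  0 <= `|x| - (abs_poly n).[x] <= Num.min `|x| (2 / n.+2%:R).
Proof.
move=> x1; have x_ge0 := normr_ge0 x.
have x2 : x ^+ 2 = `|x| ^+ 2 by rewrite real_normK ?num_real.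
elim: n => [|n]; first by rewrite hornerC subr0 x_ge0 /= le_min lexx divff.
set y := (abs_poly n).[x]; rewrite le_min => /and3P[gap_ge0 gap_le_x gap_le].
rewrite [abs_poly n.+1]/= !hornerE -/y x2 le_min.
move: `|x| x1 x_ge0 gap_ge0 gap_le_x gap_le => t t1 t_ge0 gap_ge0 gap_le_t gap_le.
have -> : t - (y + 2^-1 * (t ^+ 2 - y ^+ 2)) = (t - y) * (1 - (t + y) / 2) by field.
have -> : (t + y) / 2 = t - (t - y) / 2 by field.
move: (t - y) gap_ge0 gap_le_t gap_le => z z_ge0 z_le_t z_le.
apply/and3P; split; [nra|nra|].
set u := 2 / n.+2%:R in z_le *.
have u_le1 : u <= 1 by rewrite ler_pdivrMr // mul1r ler_nat.
have gap_contracts : z * (1 - (t - z / 2)) <= u * (1 - u / 2).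
  by apply: (@le_trans _ _ (z * (1 - z / 2))); nra.
apply: le_trans gap_contracts _; rewrite /u ler_pdivlMr // -(natr1 n.+2).
have -> : 2 / n.+2%:R * (1 - 2 / n.+2%:R / 2) * (n.+2%:R + 1) =
   2 - 2 / n.+2%:R ^+ 2 :> R by field; rewrite gt_eqF.
by rewrite lerBlDr lerDl divr_ge0 ?sqr_ge0.
Qed.

Lemma poly_approximable_norm : poly_approximable (fun x => `|x|).
Proof.
move=> B e e_gt0; pose r := `|B| + 1; have r_gt0 : 0 < r by rewrite ltr_wpDl.
have [n r_le] : exists n : nat, r * (2 / n.+2%:R) <= e.
  exists (Num.truncn (r * 2 / e)); rewrite mulrA ler_pdivrMr ?ltr0n // [e * _]mulrC -ler_pdivrMr //.
  by apply/ltW/(lt_le_trans (truncnS_gt _)); rewrite ler_nat.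
exists (r *: (abs_poly n \Po (r^-1 *: 'X))) => x xB.
have xE : `|x| = r * `|r^-1 * x| by rewrite normrM normfV (gtr0_norm r_gt0) mulVKf ?gt_eqF.
have x1 : `|r^-1 * x| <= 1.
  rewrite -(ler_pM2l r_gt0) -xE mulr1 (le_trans xB) // (le_trans (ler_norm B)) //.
  by rewrite lerDl.
have := abs_poly_bounds n x1; rewrite le_min => /and3P[gap_ge0 _ gap_le].
rewrite hornerZ horner_comp hornerZ hornerX xE -mulrBr normrM (gtr0_norm r_gt0).
by rewrite distrC ger0_norm // (le_trans _ r_le) // ler_pM2l.
Qed.

(* The ramp from -1/2 to 1/2 over [c - del, c]. *)
Definition ramp del c x := (2 * del)^-1 * (`|x - (c - del)| - `|x - c|).

Lemma ramp_bounds del c x : 0 < del ->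
  (c <= x)%R%:R - 2^-1 <= ramp del c x <= (c - del < x)%R%:R - 2^-1.
Proof.
move=> del_gt0; have [xc|cx] := leP x (c - del).
  have -> : (c <= x) = false by apply/negbTE; rewrite -ltNge; lra.
  rewrite /ramp !ler0_norm; try lra.
  rewrite (_ : _ * _ = - 2^-1) /=; [lra|by field; rewrite gt_eqF].
have norm_left : `|x - (c - del)| = x - (c - del) by rewrite ger0_norm; lra.
rewrite /ramp norm_left; have [cx'|xc] := leP c x.
  rewrite ger0_norm ?subr_ge0 // (_ : _ * _ = 2^-1) /=; [lra|by field; rewrite gt_eqF].
rewrite ler0_norm ?subr_le0 ?(ltW xc) // mulrC ler_pdivlMr ?ler_pdivrMr ?mulr_gt0 //=.
by apply/andP; split; nra.
Qed.

Definition trapezoid del a b x := ramp del a x - ramp del (b + del) x.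

Lemma indic_itvE a b x : \1_`[a, b]%classic x = (a <= x <= b)%R%:R :> R.
Proof. by rewrite indicE mem_setE in_itv. Qed.

Lemma indic_le_trapezoid del a b x : 0 < del -> a <= b ->
  \1_`[a, b]%classic x <= trapezoid del a b x.
Proof.
move=> del_gt0 ab; have /andP[ramp_a _] := ramp_bounds a x del_gt0.
have /andP[_ ramp_b] := ramp_bounds (b + del) x del_gt0; rewrite addrK in ramp_b.
rewrite indic_itvE /trapezoid; move: ramp_a ramp_b; have [xa|xa] := leP a x => /=.
  by case: leP => _ /=; lra.
by rewrite ltNge (le_trans (ltW xa)) //=; lra.
Qed.

Lemma trapezoid_le_indic del a b x : 0 < del ->
  trapezoid del a b x <= \1_`[a - del, b + del]%classic x.
Proof.
move=> del_gt0; have /andP[_ ramp_a] := ramp_bounds a x del_gt0.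
have /andP[ramp_b _] := ramp_bounds (b + del) x del_gt0.
have step_ge0 : 0 <= (b + del <= x)%R%:R :> R by [].
have indic_ge0 : 0 <= (a - del <= x <= b + del)%R%:R :> R by [].
rewrite indic_itvE /trapezoid; move: ramp_a ramp_b step_ge0 indic_ge0.
have [xa|ax] := leP x (a - del) => /=; first lra.
rewrite (ltW ax); have [xb|bx] := leP x (b + del) => /=; first lra.
by rewrite (ltW bx) /=; lra.
Qed.

Lemma trapezoid_cvg a b x : a <= b ->
  trapezoid k.+1%:R^-1 a b x @[k --> \oo] --> (\1_`[a, b]%classic x : R).
Proof.
move=> ab; have width_gt0 k : 0 < k.+1%:R^-1 :> R by rewrite invr_gt0.
pose gap := Num.max (a - x) (x - b).
have indicE w : \1_`[a - w, b + w]%classic x = (gap <= w)%R%:R :> R.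
  by rewrite indic_itvE ge_max lerBlDr [x - b <= w]lerBlDr -lerBlDl [w + b]addrC.
have outer_eq : \forall k \near \oo,
    (\1_`[a, b]%classic x : R) = \1_`[a - k.+1%:R^-1, b + k.+1%:R^-1]%classic x.
  rewrite -[a]subr0 -[b]addr0 indicE !subr0 !addr0.
  have [gap_le0|gap_gt0] := leP gap 0.
    by apply: nearW => k; rewrite indicE (le_trans gap_le0) // ltW.
  have small_width : \forall k \near \oo, k.+1%:R^-1 < gap :> R.
    exact: (@cvgr_lt _ _ _ _ _ _ (@cvg_harmonic R) gap gap_gt0).
  by apply: filterS small_width => k; rewrite indicE [gap <= _]leNgt => ->.
apply: (@squeeze_cvgr _ _ _ _ (fun=> \1_`[a, b]%classic x)
  (fun k => \1_`[a - k.+1%:R^-1, b + k.+1%:R^-1]%classic x)).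
- by apply: nearW => k; rewrite indic_le_trapezoid ?trapezoid_le_indic.
- exact: cvg_cst.
- exact: cvg_trans (near_eq_cvg outer_eq) (cvg_cst _).
Qed.

Lemma poly_approximable_ramp del c : poly_approximable (ramp del c).
Proof.
apply/poly_approximableZ/poly_approximableB.
  exact: (poly_approximable_shift (c - del) poly_approximable_norm).
exact: (poly_approximable_shift c poly_approximable_norm).
Qed.

Lemma continuous_ramp del c : continuous (ramp del c).
Proof.
have continuous_dist (y : R) : continuous (fun x => `|x - y|).
  by move=> x; apply: cvg_norm; apply: cvgB; [exact: cvg_id|exact: cvg_cst].
by move=> x; apply: cvgMl_tmp; apply: cvgB; exact: continuous_dist.
Qed.

Lemma poly_approximable_trapezoid del a b : poly_approximable (trapezoid del a b).
Proof. by apply: poly_approximableB; exact: poly_approximable_ramp. Qed.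

Lemma continuous_trapezoid del a b : continuous (trapezoid del a b).
Proof. by move=> x; apply: cvgB; exact: continuous_ramp. Qed.

End poly_approximable.

Section semicircle_approximation.
Context {R : realType}.
Variables (m v : R).
Hypothesis v_gt0 : 0 < v.
Local Notation mu := (@lebesgue_measure R).
Local Notation s := (Num.sqrt v).
Local Notation support := (`[m - 2 * s, m + 2 * s]%classic : set R).
Local Notation pdf := (semicircle_pdf m v).
Local Notation integrable_pdf f := (mu.-integrable support (EFin \o (fun x => f x * pdf x))).
Implicit Types (f g : R -> R) (p : {poly R}).

Lemma semicircle_mean_le f g : integrable_pdf f -> integrable_pdf g ->
  (forall x, support x -> f x <= g x) -> semicircle_mean m v f <= semicircle_mean m v g.
Proof.
move=> fi gi fg; apply: le_Rintegral => // x xS.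
by rewrite ler_wpM2r ?semicircle_pdf_ge0 ?fg.
Qed.

Lemma semicircle_meanN f : integrable_pdf f -> semicircle_mean m v (\- f) = - semicircle_mean m v f.
Proof.
move=> fi; rewrite -mulN1r /semicircle_mean -RintegralZl //.
by apply: eq_Rintegral => x _; rewrite mulN1r mulNr.
Qed.

Lemma continuous_integrable_pdf f : continuous f -> integrable_pdf f.
Proof.
move=> cf; apply: continuous_integrable_itv => x.
by apply: cvgM; [exact: cf|exact: semicircle_pdf_continuous].
Qed.

Lemma indic_integrable_pdf (S : set R) : measurable S -> integrable_pdf \1_S.
Proof.
move=> mS; apply: (@le_integrable _ _ _ mu _ _ _ (EFin \o pdf)) => //.
- apply/measurable_EFinP; apply: measurable_funM; first exact: measurable_indic.
  by apply: measurable_funTS; apply: continuous_measurable_fun; exact: semicircle_pdf_continuous.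
- by move=> x _; rewrite /= lee_fin normrM ler_piMl // indicE ger0_norm // lern1 leq_b1.
by apply: continuous_integrable_itv; exact: semicircle_pdf_continuous.
Qed.

Lemma semicircleE (S : set R) : semicircle m v S = semicircle_mean m v \1_S.
Proof.
rewrite /semicircle Rintegral_mkcondl; apply: eq_Rintegral => x _.
by rewrite patchE indicE; case: ifP => _; rewrite ?mul1r ?mul0r.
Qed.

Lemma semicircle_itv_le a b : a <= b -> semicircle m v `[a, b] <= (pi * s)^-1 * (b - a).
Proof.
move=> ab; have mab : measurable (`[a, b]%classic `&` support) by exact: measurableI.
have mu_ab : mu `[a, b]%classic = (b - a)%:E.
  by rewrite lebesgue_measure_itv /= lte_fin -EFinB; case: ltgtP ab => // ->; rewrite subrr.
have mu_le : (mu (`[a, b]%classic `&` support) <= (b - a)%:E)%E.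
  by rewrite -mu_ab le_measure ?inE.
have mu_fin : (mu (`[a, b]%classic `&` support) < +oo)%E by rewrite (le_lt_trans mu_le) ?ltry.
apply: (@le_trans _ _ (\int[mu]_(x in `[a, b]%classic `&` support) cst (pi * s)^-1 x)).
  apply: le_Rintegral => //.
  - apply: (@integrableS _ _ R mu support) => //.
    by apply: continuous_integrable_itv; exact: semicircle_pdf_continuous.
  - by apply: measurable_bounded_integrable => //; exact: bounded_cst.
  - by move=> x _; exact: semicircle_pdf_le.
rewrite Rintegral_cst // ler_wpM2l ?invr_ge0 ?mulr_ge0 ?pi_ge0 //.
by rewrite -lee_fin fineK // ge0_fin_numE.
Qed.

Lemma semicircle_mono (A B : set R) : measurable A -> measurable B -> A `<=` B ->
  semicircle m v A <= semicircle m v B.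
Proof.
move=> mA mB AB; rewrite !semicircleE.
apply: semicircle_mean_le => [||x _]; try exact: indic_integrable_pdf.
by rewrite !indicE ler_nat; case: (boolP (x \in A)) => // /set_mem/AB/mem_set ->.
Qed.

Lemma semicircleU_le (A B : set R) : measurable A -> measurable B ->
  semicircle m v (A `|` B) <= semicircle m v A + semicircle m v B.
Proof.
move=> mA mB; have iA := indic_integrable_pdf mA; have iB := indic_integrable_pdf mB.
rewrite !semicircleE /semicircle_mean -RintegralD //.
apply: le_Rintegral => //; first exact/indic_integrable_pdf/measurableU.
  exact: (integrableD _ iA iB).
move=> x _; rewrite -mulrDl ler_wpM2r ?semicircle_pdf_ge0 // !indicE in_setU -natrD ler_nat.
by case: (x \in A); case: (x \in B).
Qed.

Lemma semicircle_widen del a b : 0 <= del ->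
  semicircle m v `[a - del, b + del] <=
  semicircle m v `[a, b] + 2 * (pi * s)^-1 * del.
Proof.
move=> del_ge0.
have -> : 2 * (pi * s)^-1 * del = (pi * s)^-1 * del + (pi * s)^-1 * del.
  by rewrite -mulrA mulr_natl mulr2n.
apply: (@le_trans _ _ (semicircle m v (`[a, b] `|` (`[a - del, a] `|` `[b, b + del])))).
  apply: semicircle_mono => //; first by do 2 apply: measurableU => //.
  move=> x /=; rewrite !in_itv /= => /andP[ax xb].
  have [xa|ax'] := leP x a; first by right; left; rewrite ax.
  by have [bx|bx'] := leP x b; [left; rewrite ltW|right; right; rewrite ltW].
apply: le_trans (semicircleU_le _ _) _ => //; first exact: measurableU.
rewrite lerD2l; apply: le_trans (semicircleU_le _ _) _ => //.
apply: lerD; apply: le_trans (semicircle_itv_le _) _; rewrite ?lerBlDr ?lerDl //.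
  by rewrite subKr.
by rewrite addrAC subrr add0r.
Qed.

Local Notation radius := (`|m| + 2 * s).

Lemma norm_support x : support x -> `|x| <= radius.
Proof.
rewrite /= in_itv /= -lter_distl => xm.
by rewrite -[x](subrK m) addrC (le_trans (ler_normD _ _)) // lerD2l.
Qed.

Lemma horner_le_geometric p (B : R) : 0 < B ->
  exists2 c : R, 0 <= c & forall n x, (size p <= n)%N -> B <= `|x| ->
    `|p.[x]| <= c * (`|x| / B) ^+ n.
Proof.
move=> B_gt0; exists (\sum_(i < size p) `|p`_i| * B ^+ i).
  by apply: sumr_ge0 => i _; rewrite mulr_ge0 // exprn_ge0 // ltW.
move=> n x sn Bx; rewrite horner_coef (le_trans (ler_norm_sum _ _ _)) // mulr_suml.
apply: ler_sum => i _; rewrite normrM -mulrA ler_wpM2l // normrX.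
have ratio_ge1 : 1 <= `|x| / B by rewrite ler_pdivlMr // mul1r.
rewrite -[X in X ^+ i](divfK (lt0r_neq0 B_gt0)) exprMn [leLHS]mulrC.
rewrite ler_wpM2l ?exprn_ge0 ?(ltW B_gt0) //.
by apply: ler_weXn2l => //; exact: leq_trans (ltnW (ltn_ord i)) sn.
Qed.

(* [(c + 1) * (x / 2 radius)^(2l)]: at most [(c + 1) / 4^l] on the support. *)
Lemma exists_tail_poly p (eta : R) : 0 < eta ->
  exists t : {poly R}, [/\ forall x, 0 <= t.[x],
    forall x, 2 * radius <= `|x| -> `|p.[x]| + 1 <= t.[x] & semicircle_moment m v t <= eta].
Proof.
move=> eta_gt0; pose B := 2 * radius.
have s_gt0 : 0 < s by rewrite sqrtr_gt0.
have B_gt0 : 0 < B by rewrite /B mulr_gt0 // ltr_wpDl // mulr_gt0.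
have [c c_ge0 p_le] := horner_le_geometric p B_gt0.
have [l [sl el]] : exists l, (size p <= l.*2)%N /\ (c + 1) * 4^-1 ^+ l <= eta.
  pose l := maxn (size p) (Num.truncn ((c + 1) / eta)).+1; exists l; split.
    by rewrite -addnn (leq_trans (leq_maxl _ _) (leq_addr _ _)).
  rewrite exprVn ler_pdivrMr ?exprn_gt0 // -ler_pdivrMl // mulrC.
  apply: (le_trans (ltW (truncnS_gt _))); rewrite -natrX ler_nat.
  exact: leq_trans (leq_maxr _ _) (ltnW (ltn_expl _ _)).
have tE x : ((c + 1) *: (B^-1 *: 'X) ^+ l.*2).[x] = (c + 1) * (`|x| / B) ^+ l.*2.
  rewrite hornerZ horner_exp hornerZ hornerX -!mul2n !exprM; congr (_ * _ ^+ _).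
  by rewrite !exprMn real_normK ?num_real // mulrC.
have ratio_ge0 x : 0 <= `|x| / B by rewrite divr_ge0 // ltW.
exists ((c + 1) *: (B^-1 *: 'X) ^+ l.*2); split=> [x|x Bx|].
- by rewrite tE mulr_ge0 ?addr_ge0 ?exprn_ge0.
- by rewrite tE mulrDl mul1r lerD ?p_le // exprn_ege1 // ler_pdivlMr // mul1r.
apply: le_trans el; rewrite -[leRHS](semicircle_momentC m v_gt0).
apply: semicircle_mean_le => [||x /norm_support xK]; try exact: integrable_horner_pdf.
rewrite tE hornerC ler_wpM2l ?addr_ge0 // -mul2n exprM lerXn2r ?nnegrE ?exprn_ge0 //.
rewrite (_ : 4^-1 = 2^-1 ^+ 2 :> R); last by rewrite exprVn -natrX.
by rewrite lerXn2r ?nnegrE // ler_pdivrMr // mulKf.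
Qed.

Lemma poly_approximable_majorant f (eps : R) : 0 < eps ->
  poly_approximable f -> continuous f -> (forall x, f x <= 1) ->
  exists2 q : {poly R}, forall x, f x <= q.[x] &
    semicircle_moment m v q <= semicircle_mean m v f + eps.
Proof.
move=> eps_gt0 approx_f cf f1; pose eta := eps / 3.
have eta_gt0 : 0 < eta by rewrite divr_gt0.
have [p pf] := approx_f (2 * radius) _ eta_gt0.
have [t [t_ge0 t_tail t_moment]] := exists_tail_poly p eta_gt0.
exists (p + eta%:P + t) => [x|].
  rewrite !hornerD hornerC; have := t_ge0 x.
  have [/pf|/ltW/t_tail] := leP `|x| (2 * radius); first by move=> /ler_normlP[]; lra.
  by have := ler_norm (- p.[x]); rewrite normrN; have := f1 x; lra.
have p_moment : semicircle_moment m v (p - eta%:P) <= semicircle_mean m v f.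
  apply: semicircle_mean_le => [||x /norm_support xK].
  - exact: integrable_horner_pdf.
  - exact: continuous_integrable_pdf.
  rewrite !hornerE lerBlDr -lerBlDl (le_trans (ler_norm _)) // pf // (le_trans xK) //.
  by rewrite ler_peMl ?ler1n // addr_ge0 // mulr_ge0 // sqrtr_ge0.
move: p_moment t_moment; rewrite !linearD linearN /= semicircle_momentC // /eta.
move: (semicircle_moment m v p) (semicircle_moment m v t) => x y; lra.
Qed.

Lemma exists_small_width (eps : R) : 0 < eps ->
  exists2 del : R, 0 < del & 2 * (pi * s)^-1 * del <= eps.
Proof.
move=> eps_gt0; have c_gt0 : 0 < 2 * (pi * s)^-1.
  by rewrite mulr_gt0 ?invr_gt0 ?mulr_gt0 ?pi_gt0 ?sqrtr_gt0.
exists (eps / (2 * (pi * s)^-1)); first by rewrite divr_gt0.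
by rewrite [leLHS]mulrC divfK ?gt_eqF.
Qed.

Lemma semicircle_majorant a b (eps : R) : a <= b -> 0 < eps ->
  exists2 q : {poly R}, forall x, \1_`[a, b]%classic x <= q.[x] &
    semicircle_moment m v q <= semicircle m v `[a, b] + eps.
Proof.
move=> ab eps_gt0; have eps2_gt0 : 0 < eps / 2 by rewrite divr_gt0.
have [del del_gt0 del_eps] := exists_small_width eps2_gt0.
have trapezoid_le1 x : trapezoid del a b x <= 1.
  by rewrite (le_trans (trapezoid_le_indic _ _ _ del_gt0)) // indicE lern1 leq_b1.
have [q q_ge q_moment] := poly_approximable_majorant eps2_gt0
  (poly_approximable_trapezoid del a b) (@continuous_trapezoid _ del a b) trapezoid_le1.
exists q => [x|]; first exact: le_trans (indic_le_trapezoid x del_gt0 ab) (q_ge x).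
have trapezoid_mean : semicircle_mean m v (trapezoid del a b) <= semicircle m v `[a - del, b + del].
  rewrite semicircleE; apply: semicircle_mean_le => [||x _].
  - exact/continuous_integrable_pdf/continuous_trapezoid.
  - exact: indic_integrable_pdf.
  - exact: trapezoid_le_indic.
by have := semicircle_widen a b (ltW del_gt0); lra.
Qed.

Lemma semicircle_minorant a b (eps : R) : a <= b -> 0 < eps ->
  exists2 q : {poly R}, forall x, q.[x] <= \1_`[a, b]%classic x &
    semicircle m v `[a, b] - eps <= semicircle_moment m v q.
Proof.
move=> ab eps_gt0; have eps2_gt0 : 0 < eps / 2 by rewrite divr_gt0.
have [del del_gt0 del_eps] := exists_small_width eps2_gt0.
have [narrow|wide] := ltP (b - del) (a + del).
  exists 0 => [x|]; first by rewrite hornerC indicE.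
  rewrite linear0 subr_le0 (le_trans (semicircle_itv_le ab)) //.
  have : (pi * s)^-1 * (b - a) <= (pi * s)^-1 * (2 * del).
    by rewrite ler_wpM2l ?invr_ge0 ?mulr_ge0 ?pi_ge0 ?sqrtr_ge0 //; lra.
  by rewrite mulrCA mulrA; lra.
pose g := trapezoid del (a + del) (b - del).
have g_ge0 x : 0 <= g x by rewrite (le_trans _ (indic_le_trapezoid x del_gt0 wide)) // indicE.
have cNg : continuous (\- g) by move=> x; apply: cvgN; exact: continuous_trapezoid.
have Ng_le1 x : - g x <= 1 by rewrite lerNl (le_trans _ (g_ge0 x)) // lerN10.
have [q q_ge q_moment] := poly_approximable_majorant eps2_gt0
  (poly_approximableN (@poly_approximable_trapezoid _ del (a + del) (b - del))) cNg Ng_le1.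
exists (- q) => [x|].
  have := trapezoid_le_indic (a + del) (b - del) x del_gt0; rewrite addrK subrK.
  by apply: le_trans; rewrite hornerN lerNl; exact: q_ge.
have g_mean : semicircle m v `[a + del, b - del] <= semicircle_mean m v g.
  rewrite semicircleE; apply: semicircle_mean_le => [||x _].
  - exact: indic_integrable_pdf.
  - exact/continuous_integrable_pdf/continuous_trapezoid.
  - exact: indic_le_trapezoid.
have := semicircle_widen (a + del) (b - del) (ltW del_gt0); rewrite addrK subrK linearN /=.
move: q_moment; rewrite semicircle_meanN; last exact/continuous_integrable_pdf/continuous_trapezoid.
by move: (semicircle_moment m v q) => x; lra.
Qed.

Lemma semicircle_centered_sandwich a b (eps : R) : a <= b -> 0 < eps ->
  exists q1 q2 : {poly R}, [/\ semicircle_moment m v q1 = 0, semicircle_moment m v q2 = 0 &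
    forall x, q1.[x] - eps <= \1_`[a, b]%classic x - semicircle m v `[a, b] <= q2.[x] + eps].
Proof.
move=> ab eps_gt0.
have [q1 q1_le q1_moment] := semicircle_minorant ab eps_gt0.
have [q2 q2_ge q2_moment] := semicircle_majorant ab eps_gt0.
pose center (q : {poly R}) := q - (semicircle_moment m v q)%:P.
have center_moment q : semicircle_moment m v (center q) = 0.
  by rewrite linearB /= semicircle_momentC ?subrr.
exists (center q1), (center q2); split=> // x; rewrite !hornerE.
by have := q1_le x; have := q2_ge x; lra.
Qed.

End semicircle_approximation.

(** * Spectral measures *)

Lemma conj_exp (K : pzRingType) (u v x : K) k : u * v = 1 -> v * u = 1 ->
  (v * x * u) ^+ k = v * x ^+ k * u.
Proof.
move=> uv vu; elim: k => [|k IH]; first by rewrite !expr0 mulr1.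
by rewrite !exprS IH !mulrA -(mulrA _ u v) uv mulr1.
Qed.

Lemma diag_mx_exp (K : comPzRingType) n (r : 'rV[K]_n) k :
  diag_mx r ^+ k = diag_mx (\row_i r 0 i ^+ k).
Proof.
elim: k => [|k IH]; first by apply/matrixP => i j; rewrite expr0 !mxE expr0.
rewrite exprS IH -mulmxE mulmx_diag; congr diag_mx; apply/rowP => i.
by rewrite !mxE exprS.
Qed.

Section spectral_traces.
Context {R : realType} (n : nat).
Local Notation C := (Cplx R).
Implicit Types (A : 'M[C]_n) (q : {poly R}).

Definition herm_part A : 'M[C]_n := 2^-1 *: (A + A^t*).

Definition real_eig A (i : 'I_n) : R := rpart (spectral_diag A 0 i).

Lemma diag_mx_conj (r : 'rV[C]_n) : (diag_mx r)^t* = diag_mx (map_mx Num.conj r).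
Proof. by rewrite tr_diag_mx map_diag_mx. Qed.

Lemma herm_part_unitary (P : 'M[C]_n) (r : 'rV[C]_n) :
  herm_part (P^t* *m diag_mx r *m P) = P^t* *m diag_mx (map_mx (creal \o rpart) r) *m P.
Proof.
have -> : diag_mx (map_mx (creal \o rpart) r) = 2^-1 *: (diag_mx r + (diag_mx r)^t*).
  by rewrite diag_mx_conj; apply/matrixP => i j; rewrite !mxE /= creal_rpartE -mulrnDl mulrnAr.
by rewrite /herm_part !trmx_mul !map_mxM trmxCK mulmxA -scalemxAr -scalemxAl mulmxDr mulmxDl.
Qed.

Lemma mxtrace_herm_part_exp A k : A \is normalmx ->
  \tr (herm_part A ^+ k) = \sum_i creal (real_eig A i) ^+ k.
Proof.
move=> /orthomx_spectralP; rewrite /real_eig.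
have := spectral_unitarymx A; move: (spectralmx A) (spectral_diag A) => P r P_unitary.
rewrite invmx_unitary // => ->; rewrite herm_part_unitary.
have PPt : P *m P^t* = 1%:M by exact/unitarymxP.
rewrite -[_ *m P]/(P^t* * diag_mx (map_mx (creal \o rpart) r) * P) conj_exp //; last exact: mulmx1C.
rewrite [LHS]mxtrace_mulC mulmxA PPt mul1mx diag_mx_exp mxtrace_diag.
by apply: eq_bigr => i _; rewrite !mxE.
Qed.

Definition spectral_mean (f : R -> R) A : R := n%:R^-1 * \sum_i f (real_eig A i).

Lemma spectral_measureE A (S : set R) : spectral_measure A S = spectral_mean \1_S A.
Proof. by []. Qed.

Lemma spectral_mean_le (f g : R -> R) A : (forall x, f x <= g x) ->
  spectral_mean f A <= spectral_mean g A.
Proof. by move=> fg; rewrite ler_wpM2l ?invr_ge0 //; apply: ler_sum => i _; exact: fg. Qed.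

Definition poly_trace q A : C :=
  n%:R^-1 * \sum_(k < size q) creal q`_k * \tr (herm_part A ^+ k).

Lemma poly_traceE q A : A \is normalmx ->
  poly_trace q A = creal (spectral_mean (horner q) A).
Proof.
move=> A_normal; rewrite rmorphM fmorphV rmorph_nat rmorph_sum; congr (_ * _).
under eq_bigr do rewrite mxtrace_herm_part_exp // mulr_sumr.
rewrite exchange_big; apply: eq_bigr => i _; rewrite horner_coef rmorph_sum.
by apply: eq_bigr => k _; rewrite /= rmorphM rmorphXn.
Qed.

(* The junk value of [spectral_diag] off the normal matrices. *)
Lemma real_eig_not_normal A i : A \isn't normalmx -> real_eig A i = 0.
Proof.
move=> A_not_normal; rewrite /real_eig /spectral_diag.
case: orthomx_spectral_subproof => [AP|_]; last by rewrite mxE.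
by case/negP: A_not_normal; apply/orthomx_spectral_subproof.
Qed.

Lemma herm_part_continuous : continuous herm_part.
Proof.
apply: mx_continuous => i j; under eq_fun do rewrite !mxE.
apply: mulr_continuous; first exact: cst_continuous.
by apply: addr_continuous; [exact: entry_continuous|exact: conj_entry_continuous].
Qed.

Lemma poly_trace_continuous q : continuous (poly_trace q).
Proof.
apply: mulr_continuous; first exact: cst_continuous.
apply: sum_continuous => k; apply: mulr_continuous; first exact: cst_continuous.
apply: sum_continuous => i; apply: mx_entry_continuous.
elim: (k : nat) => [|l IH]; first exact: cst_continuous.
rewrite (_ : (fun A => _) = fun A => herm_part A *m herm_part A ^+ l).
  exact: mulmx_continuous herm_part_continuous IH.
by apply/funext => A; rewrite exprS.
Qed.

Lemma closed_normalmx : closed [set A : 'M[C]_n | A \is normalmx].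
Proof.
pose comm (ij : 'I_n * 'I_n) A : C :=
  (A *m A^t*) ij.1 ij.2 + -1 * (A^t* *m A) ij.1 ij.2.
rewrite (_ : mkset _ = \bigcap_(ij in [set: 'I_n * 'I_n]) [set A | comm ij A = 0]).
  have cJ := @conjmx_continuous R n n; have c_id : continuous (@idfun 'M[C]_n).
    by move=> A; exact: cvg_id.
  apply: closed_bigI => ij _; apply: closed_fiber; apply: addr_continuous.
    exact: mx_entry_continuous (mulmx_continuous c_id cJ).
  apply: mulr_continuous; first exact: cst_continuous.
  exact: mx_entry_continuous (mulmx_continuous cJ c_id).
apply/seteqP; split=> [A /normalmxP AA ij _|A AA].
  by rewrite /comm /= AA mulN1r subrr.
by apply/normalmxP/matrixP => i j; apply/eqP; rewrite -subr_eq0 -mulN1r; exact/eqP/(AA (i, j)).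
Qed.

Lemma measurable_spectral_mean_horner q :
  measurable_fun setT (spectral_mean (horner q) : borelM R n n -> R).
Proof.
have m_normal : measurable ([set A | A \is normalmx] : set (borelM R n n)).
  exact: closed_borelM closed_normalmx.
rewrite (_ : spectral_mean _ = fun A => if A \is normalmx then rpart (poly_trace q A)
    else n%:R^-1 * \sum_(i < n) q.[0]).
  apply: measurable_fun_ifT.
  - by apply: (measurable_fun_bool true); rewrite setTI; exact: m_normal.
  - apply: continuous_borelM_real => A; apply: continuous_comp; first exact: poly_trace_continuous.
    exact: rpart_continuous.
  - exact: measurable_cst.
apply/funext => A; case: ifPn => A_normal; first by rewrite poly_traceE.
by congr (_ * _); apply: eq_bigr => i _; rewrite real_eig_not_normal.
Qed.

Lemma measurable_spectral_mean_cvg (f_ : nat -> R -> R) (f : R -> R) :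
  (forall k, measurable_fun setT (spectral_mean (f_ k) : borelM R n n -> R)) ->
  (forall x, f_ k x @[k --> \oo] --> f x) ->
  measurable_fun setT (spectral_mean f : borelM R n n -> R).
Proof.
move=> mf cvg_f; apply: (measurable_fun_cvg mf) => A _.
by apply: cvgMl_tmp; apply: cvg_big => [|i _]; [exact: add_continuous|exact: cvg_f].
Qed.

Lemma measurable_spectral_mean_approximable (f : R -> R) : poly_approximable f ->
  measurable_fun setT (spectral_mean f : borelM R n n -> R).
Proof.
move=> approx_f; have inv_gt0 k : 0 < k.+1%:R^-1 :> R by rewrite invr_gt0.
have [p pf] := choice (fun k => approx_f k%:R _ (inv_gt0 k)).
apply: (@measurable_spectral_mean_cvg (fun k => horner (p k))) => [k|x].
  exact: measurable_spectral_mean_horner.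
apply/cvgrPdist_le => e e_gt0.
have /cvgrPdist_le/(_ e e_gt0) := @cvg_harmonic R; apply: filterS2; last first.
  exact: (nbhs_infty_ger `|x|).
move=> k xk; rewrite sub0r normrN ger0_norm /= ?invr_ge0 // distrC.
exact: le_trans (pf k x xk).
Qed.

Lemma measurable_spectral_measure a b : a <= b ->
  measurable_fun setT (fun A : borelM R n n => spectral_measure (A : 'M[C]_n) `[a, b]).
Proof.
move=> ab; apply: (@measurable_spectral_mean_cvg (fun k => trapezoid k.+1%:R^-1 a b)).
  by move=> k; apply: measurable_spectral_mean_approximable; exact: poly_approximable_trapezoid.
by move=> x; exact: trapezoid_cvg.
Qed.

End spectral_traces.

(** * Concentration of the spectral measure *)

Lemma spectral_mean_addC (R : realType) n (f : R -> R) c (A : 'M[Cplx R]_n) : (0 < n)%N ->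
  spectral_mean (fun x => f x + c) A = spectral_mean f A + c.
Proof.
move=> n_gt0; rewrite /spectral_mean big_split mulrDr /= sumr_const card_ord.
by rewrite -[c *+ n]mulr_natl mulKf // pnatr_eq0 -lt0n.
Qed.

Lemma ptranspose_continuous (R : realType) m n (c : Cplx R) :
  continuous (fun A : 'M[Cplx R]_(m * n) => c *: ptranspose A).
Proof.
apply: mx_continuous => i j; under eq_fun do rewrite !mxE.
by apply: mulr_continuous; [exact: cst_continuous|exact: entry_continuous].
Qed.

Lemma reduced_state_continuous (R : realType) n p : continuous (@reduced_state R n p).
Proof.
apply: mx_continuous => i j; under eq_fun do rewrite mxE.
apply: sum_continuous => k; under eq_fun do rewrite mxE big_ord1 !mxE.
by apply: mulr_continuous; [exact: entry_continuous|exact: conj_entry_continuous].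
Qed.

Section pt_state_spectrum.
Context {R : realType} (m n p : nat).
Local Notation C := (Cplx R).
Implicit Types (x : 'cV[C]_(m * n * p)) (q : {poly R}) (S : set R).

Lemma pt_state_adjoint x : (pt_state x)^t* = pt_state x.
Proof.
apply/matrixP => i j; rewrite !mxE rmorphM /= conjC_nat; congr (_ * _).
rewrite rmorph_sum; apply: eq_bigr => k _ /=.
by rewrite !mxE rmorph_sum; apply: eq_bigr => l _; rewrite !mxE rmorphM /= conjCK mulrC.
Qed.

Lemma pt_state_normal x : pt_state x \is normalmx.
Proof. by apply/normalmxP; rewrite pt_state_adjoint. Qed.

Lemma herm_part_pt_state x : herm_part (pt_state x) = pt_state x.
Proof.
by rewrite /herm_part pt_state_adjoint; apply/matrixP => i j; rewrite !mxE; field.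
Qed.

Lemma poly_trace_pt_state q x :
  poly_trace q (pt_state x) = \sum_(k < size q) creal q`_k * ntrace k x.
Proof.
rewrite /poly_trace mulr_sumr; apply: eq_bigr => k _.
by rewrite herm_part_pt_state mulrCA.
Qed.

Lemma bounded_poly_trace_pt_state q :
  bounded_continuous (fun x => poly_trace q (pt_state x)).
Proof.
under eq_fun do rewrite poly_trace_pt_state.
by apply: bounded_continuous_sum => k _; apply: bounded_continuousZ; exact: bounded_ntrace.
Qed.

Definition pt_deviation S (s eps : R) : set 'M[C]_(m * n) :=
  [set A | eps < `|spectral_measure ((m * n)%:R *: ptranspose A) S - s|].

Lemma measurable_pt_deviation a b (s eps : R) : a <= b ->
  measurable (pt_deviation `[a, b] s eps : set (borelM R (m * n) (m * n))).
Proof.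
move=> ab; pose T (A : borelM R (m * n) (m * n)) : borelM R (m * n) (m * n) :=
  (m * n)%:R *: ptranspose (A : 'M[C]_(m * n)).
have mT : measurable_fun setT T := continuous_borelM (@ptranspose_continuous R m n _).
have mN := measurableT_comp (measurable_spectral_measure (n := (m * n)%N) ab) mT.
pose gap A := `|spectral_measure (T A : 'M[C]_(m * n)) `[a, b] - s|.
have mgap : measurable_fun setT gap by apply: measurableT_comp => //; apply: measurable_funB.
have -> : pt_deviation `[a, b] s eps = setT `&` gap @^-1` `]eps, +oo[.
  by rewrite setTI; apply/seteqP; split=> A /=; rewrite in_itv /= andbT.
exact: mgap.
Qed.

Variable nu : probability (borelM R (m * n * p) 1) R.

Definition second_moment q : R := rpart (expect nu (fun x => poly_trace q (pt_state x) ^+ 2)).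

Lemma second_momentE q : second_moment q = \sum_(k < size q) \sum_(l < size q)
  q`_k * q`_l * rpart (expect nu (fun x => ntrace k x * ntrace l x)).
Proof.
have bM k l : bounded_continuous (fun x : 'cV[C]_(m * n * p) => ntrace k x * ntrace l x).
  by apply: bounded_continuousM; exact: bounded_ntrace.
have -> : second_moment q = rpart (\sum_(k < size q) \sum_(l < size q)
    creal (q`_k * q`_l) * expect nu (fun x => ntrace k x * ntrace l x)).
  congr rpart; transitivity (expect nu (fun x => \sum_(k < size q) \sum_(l < size q)
      creal (q`_k * q`_l) * (ntrace k x * ntrace l x))).
    apply: eq_expect => x _; rewrite poly_trace_pt_state expr2 mulr_suml.
    apply: eq_bigr => k _; rewrite mulr_sumr; apply: eq_bigr => l _.
    by rewrite rmorphM mulrACA.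
  rewrite expect_sum => [|k _]; last first.
    by apply: bounded_continuous_sum => l _; exact: bounded_continuousZ.
  apply: eq_bigr => k _; rewrite expect_sum => [|l _]; last exact: bounded_continuousZ.
  by apply: eq_bigr => l _; rewrite expectZ.
rewrite raddf_sum; apply: eq_bigr => k _; rewrite raddf_sum; apply: eq_bigr => l _.
exact: rpart_crealM.
Qed.

Hypotheses (m_gt0 : (0 < m)%N) (n_gt0 : (0 < n)%N).
Hypothesis nu_uniform : uniform_on_sphere nu.

(* Chebyshev's inequality: on the deviation event, one of the two polynomial
   traces is at least [eps / 2]. *)
Lemma pt_deviation_le q1 q2 a b (s eps : R) : a <= b -> 0 < eps ->
  (forall x : R, q1.[x] - eps / 2 <= \1_`[a, b]%classic x - s <= q2.[x] + eps / 2) ->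
  (nu (@reduced_state R (m * n) p @^-1` pt_deviation `[a, b] s eps) <=
    (4 / eps ^+ 2 * (second_moment q1 + second_moment q2))%:E)%E.
Proof.
move=> ab eps_gt0 sandwich.
pose f x := creal (4 / eps ^+ 2) *
  (poly_trace q1 (pt_state x) ^+ 2 + poly_trace q2 (pt_state x) ^+ 2).
have b2 q : bounded_continuous (fun x => poly_trace q (pt_state x) ^+ 2).
  by apply: bounded_continuousM; exact: bounded_poly_trace_pt_state.
have bf : bounded_continuous f by apply: bounded_continuousZ; exact: bounded_continuousD.
have fE x : rpart (f x) = 4 / eps ^+ 2 * (spectral_mean (horner q1) (pt_state x) ^+ 2 +
    spectral_mean (horner q2) (pt_state x) ^+ 2).
  by rewrite /f !poly_traceE ?pt_state_normal // -!rmorphXn -rmorphD rpart_crealM.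
have -> : 4 / eps ^+ 2 * (second_moment q1 + second_moment q2) = rpart (expect nu f).
  by rewrite /f expectZ ?expectD ?rpart_crealM ?raddfD //; exact: bounded_continuousD.
apply: uniform_measure_le_expect => // [|x|x dev].
- rewrite -[X in measurable X]setTI.
  apply: (continuous_borelM (@reduced_state_continuous R (m * n) p)) => //.
  exact: measurable_pt_deviation.
- by rewrite fE mulr_ge0 ?addr_ge0 ?sqr_ge0 // divr_ge0 ?sqr_ge0.
have mn_gt0 : (0 < m * n)%N by rewrite muln_gt0 m_gt0.
have lower := spectral_mean_le (pt_state x) (fun y => proj1 (andP (sandwich y))).
have upper := spectral_mean_le (pt_state x) (fun y => proj2 (andP (sandwich y))).
move: lower upper dev; rewrite !spectral_mean_addC // -spectral_measureE fE /pt_deviation /=.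
rewrite -/(pt_state x) mulrAC ler_pdivlMr ?exprn_gt0 // mul1r.
move: (spectral_measure _ _) (spectral_mean (horner q1) _) (spectral_mean (horner q2) _).
move=> N t1 t2 lower upper; rewrite ltNge ler_norml negb_and -!ltNge => /orP[below|above].
  have t1_le : t1 <= - (eps / 2) by lra.
  by have := sqr_ge0 t2; nra.
have t2_ge : eps / 2 <= t2 by lra.
by have := sqr_ge0 t1; nra.
Qed.

End pt_state_spectrum.

Section deviation_limit.
Context {R : realType} (v : R) (p : nat -> nat).
Hypothesis v_gt0 : 0 < v.
Hypothesis ratio_cvg : n%:R ^+ 2 / (p n)%:R @[n --> \oo] --> v.
Variable nu : forall d, probability (borelM R (d * d * p d) 1) R.
Hypothesis nu_uniform : \forall d \near \oo, uniform_on_sphere (nu d).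

Lemma mixed_moment_cvg k l :
  rpart (expect (nu d) (fun x => ntrace k x * ntrace l x)) @[d --> \oo] -->
    motzkin 1 v k 0 * motzkin 1 v l 0.
Proof.
have L_empty : \forall d \near \oo,
    normalized_net (nu d) finset.set0 1%g (1%g : {perm 'I_k + 'I_l}) = 1.
  apply: filterS2 (dims_gt0_near v_gt0 ratio_cvg) nu_uniform => d /andP[d_gt0 p_gt0] nu_d.
  exact: normalized_net_empty.
have L_rec : \forall d \near \oo, forall (A : {set 'I_k + 'I_l}) (g h : {perm 'I_k + 'I_l}) t,
    t \in A -> normalized_net (nu d) A g h = \sum_(s in A) splice_weight d d (p d) #|A| g h s t *
      normalized_net (nu d) (A :\ s) (splice s t g) (splice s t h).
  apply: filterS2 (dims_gt0_near v_gt0 ratio_cvg) nu_uniform => d /andP[d_gt0 p_gt0] nu_d.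
  move=> A g h t tA.
  exact: normalized_net_rec.
have := net_cycles_cvg v_gt0 ratio_cvg L_empty L_rec (has_cycles_double_rotation k l).
rewrite rotation_cycles_full !big_cons big_nil mulr1 size_map size_enum_ord size_map size_enum_ord.
apply: cvg_trans; apply: near_eq_cvg.
apply: filterS2 (dims_gt0_near v_gt0 ratio_cvg) nu_uniform => d /andP[d_gt0 p_gt0] nu_d.
by rewrite rpart_expect_mul_ntrace.
Qed.

Lemma second_moment_cvg (q : {poly R}) :
  second_moment (nu d) q @[d --> \oo] --> semicircle_moment 1 v q ^+ 2.
Proof.
have -> : semicircle_moment 1 v q ^+ 2 = \sum_(k < size q) \sum_(l < size q)
    q`_k * q`_l * (motzkin 1 v k 0 * motzkin 1 v l 0).
  rewrite -{1}[q]coefK poly_def linear_sum expr2 mulr_suml; apply: eq_bigr => k _.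
  rewrite mulr_sumr; apply: eq_bigr => l _.
  by rewrite !linearZ /= !semicircle_momentX // mulrACA.
under eq_fun do rewrite second_momentE.
apply: cvg_big => [|k _]; first exact: add_continuous.
apply: cvg_big => [|l _]; first exact: add_continuous.
by apply: cvgMl_tmp; exact: mixed_moment_cvg.
Qed.

Lemma pt_deviation_cvg a b (eps : R) : a <= b -> 0 < eps ->
  nu d (@reduced_state R (d * d) (p d) @^-1`
    pt_deviation `[a, b] (semicircle 1 v `[a, b]) eps) @[d --> \oo] --> 0%E.
Proof.
move=> ab eps_gt0; have eps2_gt0 : 0 < eps / 2 by rewrite divr_gt0.
have [q1 [q2 [q1_moment q2_moment sandwich]]] := semicircle_centered_sandwich 1 v_gt0 ab eps2_gt0.
pose bound d := 4 / eps ^+ 2 * (second_moment (nu d) q1 + second_moment (nu d) q2).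
have bound_cvg : bound d @[d --> \oo] --> (0 : R).
  have -> : 0 = 4 / eps ^+ 2 * (semicircle_moment 1 v q1 ^+ 2 + semicircle_moment 1 v q2 ^+ 2) :> R.
    by rewrite q1_moment q2_moment expr0n addr0 mulr0.
  by apply: cvgMl_tmp; apply: cvgD; exact: second_moment_cvg.
apply: (@squeeze_cvge _ _ _ _ (cst 0%E) _ (fun d => (bound d)%:E)).
- apply: filterS2 (dims_gt0_near v_gt0 ratio_cvg) nu_uniform => d /andP[d_gt0 p_gt0] nu_d.
  by rewrite measure_ge0; apply: pt_deviation_le.
- exact: cvg_cst.
- by apply: cvg_EFin => //; exact: nearW.
Qed.

End deviation_limit.

Lemma truncn_ratio_cvg (R : realType) (alpha : R) (u : nat -> R) : 0 <= alpha ->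
  u n @[n --> \oo] --> +oo -> (Num.truncn (alpha * u n))%:R / u n @[n --> \oo] --> alpha.
Proof.
move=> alpha_ge0 u_cvgy; have u_gt0 : \forall n \near \oo, 0 < u n by exact: cvgry_gt.
apply: (@squeeze_cvgr _ _ _ _ (fun n => alpha - (u n)^-1) (fun=> alpha)).
- apply: filterS u_gt0 => n un_gt0.
  have /andP[truncn_le lt_truncnS] := truncn_itv (mulr_ge0 alpha_ge0 (ltW un_gt0)).
  rewrite ler_pdivrMr // truncn_le andbT ler_pdivlMr // mulrBl mulVf ?gt_eqF //.
  by rewrite lerBlDr natr1 ltW.
- rewrite -[X in _ --> X]subr0; apply: cvgB; first exact: cvg_cst.
  exact/gtr0_cvgV0.
- exact: cvg_cst.
Qed.

Lemma has_law_mu_choice (R : realType) (n p : nat -> nat) (lawful : pred nat)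
    (disp : nat -> measure_display) (T : forall d, measurableType (disp d))
    (P : forall d, probability (T d) R) (rho : forall d, {RV (P d) >-> borelM R (n d) (n d)}) :
  (forall d, lawful d -> has_law_mu (p d) (rho d)) ->
  exists nu : forall d, probability (borelM R (n d * p d) 1) R, forall d, lawful d ->
    uniform_on_sphere (nu d) /\ forall A : set (borelM R (n d) (n d)), measurable A ->
      distribution (P d) (rho d) A = nu d (@reduced_state R (n d) (p d) @^-1` A).
Proof.
move=> rho_law; pose witness d (nu : probability (borelM R (n d * p d) 1) R) := lawful d ->
  uniform_on_sphere nu /\ forall A : set (borelM R (n d) (n d)), measurable A ->
    distribution (P d) (rho d) A = nu (@reduced_state R (n d) (p d) @^-1` A).
have exists_witness d : exists nu, witness d nu.
  have [/rho_law[nu nuP]|not_lawful] := boolP (lawful d); first by exists nu.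
  (* any probability measure will do *)
  by exists (dirac (0 : borelM R (n d * p d) 1)) => lawful_d; case/negP: not_lawful.
exists (fun d => projT1 (cid (exists_witness d))) => d.
exact: projT2 (cid (exists_witness d)).
Qed.

Theorem theorem3 (R : realType) (alpha : R) (alpha_gt0 : 0 < alpha)
  (disp : nat -> measure_display)
  (T : forall d : nat, measurableType (disp d))
  (P : forall d : nat, probability (T d) R)
  (rho : forall d : nat, {RV (P d) >-> borelM R (d * d) (d * d)})
  (rho_law : forall d : nat,
     (0 < d)%N -> (0 < Num.truncn (alpha * d%:R ^+ 2))%N ->
     has_law_mu (Num.truncn (alpha * d%:R ^+ 2)) (rho d))
  (a b : R) (leab : a <= b) (eps : R) (eps_gt0 : 0 < eps) :
  (fun d : nat =>
     P d [set w : T d |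
       eps < `| spectral_measure ((d ^ 2)%:R *: ptranspose (rho d w)) `[a, b]
                - semicircle 1 (1 / alpha) `[a, b] |])
  @ \oo --> 0%E.
Proof.
pose p d := Num.truncn (alpha * d%:R ^+ 2).
have v_gt0 : 0 < 1 / alpha by rewrite divr_gt0.
have ratio_cvg : d%:R ^+ 2 / (p d)%:R @[d --> \oo] --> 1 / alpha.
  under eq_fun do rewrite -invf_div; rewrite div1r; apply: cvgV; first by rewrite gt_eqF.
  apply: truncn_ratio_cvg (ltW alpha_gt0) _.
  exact: cvg_comp (@cvgr_idn R) (@cvgr_expr2 R).
have dims_gt0 := dims_gt0_near v_gt0 ratio_cvg.
have rho_law' d : (0 < d)%N && (0 < p d)%N -> has_law_mu (p d) (rho d).
  by move=> /andP[]; exact: rho_law.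
have [nu nuP] := has_law_mu_choice rho_law'.
have nu_uniform : \forall d \near \oo, uniform_on_sphere (nu d).
  by apply: filterS dims_gt0 => d /nuP[].
apply: cvg_trans (pt_deviation_cvg v_gt0 ratio_cvg nu_uniform leab eps_gt0).
apply: near_eq_cvg; apply: filterS dims_gt0 => d /nuP[_ nu_law].
by rewrite -nu_law; last exact: measurable_pt_deviation.
Qed.
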